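(* Let $U\subset\mathbb{R}^2$ be a semialgebraic neighborhood of $0$, let $f:U\to\mathbb{R}$ be a semialgebraic function, continuous at $0$ with $f(0)=0$, and let $V=\Gamma f\subset\mathbb{R}^3$ be its graph. Assume that $V$ is a $C^1$-manifold everywhere except at $\mathbf 0\in V$, that the tangent cone of $V$ at $\mathbf 0$ is the $xy$-plane, that the positive $y$-axis is an exceptional ray of $V$, and that $m,\epsilon>0$ are such that it is the only exceptional ray in the wedge $W=\{(x,y): 0\le y\le\epsilon,\ |x|\le my\}$. Suppose there exists a piece $P=P_1\cup P_2\cup P_3\subset\Gamma f|_W$, with $P_1,P_2,P_3$ consecutive pieces, such that $P_2$ is flat ($FL$), one of $P_1$ and $P_3$ is never fast increasing ($NFI$) and the other is never fast decreasing ($NFD$), and $w(P)<\min(h(P_1),h(P_3))$, where $w$ denotes width and $h$ denotes height. Then $P$ is not $\ell$-regular, and consequently $V$ is not bilipschitz homeomorphic to the plane (as germs at the origin: no neighborhood of $\mathbf 0$ in $V$ is bilipschitz homeomorphic to a neighborhood of $0$ in $\mathbb{R}^2$).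
   Context: Tangent cone: the set of limits of $t_nx_n$ with $x_n\in V\setminus\{\mathbf 0\}$, $x_n\to\mathbf 0$, $t_n>0$. For a ray $\ell$ from $\mathbf 0$ in the tangent cone, $\mathcal N_\ell(V,\mathbf 0)$ is the set of 2-planes that are limits of tangent planes $T_{x_n}V$ along sequences of smooth points $x_n\to\mathbf 0$ with $x_n/|x_n|$ converging to the direction of $\ell$. The ray $\ell$ is exceptional if $\mathcal N_\ell(V,\mathbf 0)$ is connected, closed and one-dimensional; it is known that there are at most finitely many exceptional rays and that $\mathcal N_\ell$ is a single plane for every other ray in the tangent cone. All statements are local at $\mathbf 0$; $U$, $V$, $\epsilon$ may be shrunk as necessary. A ''unit'' is a function of $y$ with a finite nonzero limit as $y\to0^+$. Pieces. Let $x=r_1(y)$ and $x=r_2(y)$, $0\le y\le\epsilon$, be analytic arcs (convergent Puiseux expansions) with $-my\le r_1(y)<r_2(y)\le my$ for $y>0$, and let $D=\{0\le y\le\epsilon,\ r_1(y)\le x\le r_2(y)\}$. The set $P=\Gamma f|_D$ is called a piece if it is semialgebraic. Its width is the positive rational $w=w(P)$ with $|r_2(y)-r_1(y)|=y^{1/w}\cdot\text{unit}$. For each $y$ let $(x_{\max}(y),y)$ and $(x_{\min}(y),y)$ be points (forming arcs) at which $x\mapsto f(x,y)$ attains its maximum and minimum on $[r_1(y),r_2(y)]$; the height of $P$ is the positive rational $h=h(P)$ with $|f(x_{\max}(y),y)-f(x_{\min}(y),y)|=y^{1/h}\cdot\text{unit}$. Pieces are consecutive if they lie over regions bounded by arcs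 $r_i(y)\le x\le r_{i+1}(y)$ with $r_i$ strictly increasing in $i$ for $y>0$ (so neighboring ones share exactly a bounding arc). The partial derivative $f_x$ is allowed to take the values $\pm\infty$ at points where the tangent plane of $V$ is vertical. A piece $P$ over $D$ is: - flat ($FL$) if there is $K>0$ with $|f_x|\le K$ on $D$; - fast increasing ($FI$) if there is $K>0$ with $f_x\ge K$ on $D$ and there is an arc $r_3(y)$, $r_1(y)\le r_3(y)\le r_2(y)$, with $f_x(r_3(y),y)=\infty$ for all $0<y<\epsilon$, or $f_x(r_3(y),y)\to\infty$ as $y\to0$; - fast decreasing ($FD$) if there is $K>0$ with $f_x\le-K$ on $D$ and there is such an arc $r_3$ with $f_x(r_3(y),y)=-\infty$ for all $0<y<\epsilon$, or $f_x(r_3(y),y)\to-\infty$ as $y\to0$; - never fast increasing ($NFI$) if $P$ is a (finite) union of neighboring pieces (having an arc as common intersection), each of which is $FL$ or $FD$; - never fast decreasing ($NFD$) if $P$ is a (finite) union of neighboring pieces, each of which is $FL$ or $FI$. $\ell$-regularity. For a semialgebraic set $X$, $d_o(p,q)=|p-q|$ is the outer (Euclidean) distance and $d_i(p,q)$ is the inner distance, the infimum of lengths of piecewise analytic arcs in $X$ joining $p$ and $q$. $X$ is $\ell$-regular (normally embedded) if there are a neighborhood of $\mathbf 0$ in $X$ and $K>0$ such that $d_i(p,q)\le K\,d_o(p,q)$ for all $p,q$ in that neighborhood. Bilipschitz homeomorphic means via a homeomorphism preserving the origin that is bilipschitz for the outer (Euclidean) metrics. *)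

(* Defs.v *)
From HB Require Import structures.
From mathcomp Require Import all_boot all_order all_algebra.
From mathcomp Require Import all_classical all_reals all_analysis.
(* without its notations, which clash with those of MathComp-Analysis *)
From mathcomp Require Import -(notations) mpoly.

Set Implicit Arguments.
Unset Strict Implicit.
Unset Printing Implicit Defensive.

Import Order.TTheory GRing.Theory Num.Theory.
Import numFieldNormedType.Exports.
Local Open Scope classical_set_scope.
Local Open Scope ring_scope.

(* The library norm on 'rV[R]_n is the sup norm; it is used only for the
   topology.  All distances below are Euclidean. *)
Definition enorm {R : realType} {n} (v : 'rV[R]_n) : R :=
  Num.sqrt (\sum_i v 0 i ^+ 2).

Definition vec2 {R : realType} (x y : R) : 'rV[R]_2 :=
  \row_(i < 2) [:: x; y]`_i.

Definition vec3 {R : realType} (x y z : R) : 'rV[R]_3 :=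
  \row_(i < 3) [:: x; y; z]`_i.

Definition xcoord {R : realType} {n} (p : 'rV[R]_n.+1) : R := p 0 ord0.
Definition ycoord {R : realType} {n} (p : 'rV[R]_n.+2) : R := p 0 (inord 1).
Definition zcoord {R : realType} {n} (p : 'rV[R]_n.+3) : R := p 0 (inord 2).

Definition graph {R : realType} (f : 'rV[R]_2 -> R) (D : set 'rV[R]_2) :
    set 'rV[R]_3 :=
  [set vec3 (xcoord q) (ycoord q) (f q) | q in D].

Definition basic_semialgebraic {R : realType} {n}
    (c : seq (mpoly n R) * seq (mpoly n R)) : set 'rV[R]_n :=
  [set x | (forall p, p \in c.1 -> meval (fun i => x 0 i) p = 0) /\
           (forall q, q \in c.2 -> 0 < meval (fun i => x 0 i) q)].

Definition semialgebraic {R : realType} {n} (S : set 'rV[R]_n) : Prop :=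
  exists F : seq (seq (mpoly n R) * seq (mpoly n R)),
    S = [set x | exists2 c, c \in F & basic_semialgebraic c x].

Definition semialgebraic_fun {R : realType}
    (U : set 'rV[R]_2) (f : 'rV[R]_2 -> R) : Prop :=
  semialgebraic U /\ semialgebraic (graph f U).

Definition tangent_cone {R : realType} {n} (X : set 'rV[R]_n) : set 'rV[R]_n :=
  [set v | exists (x : nat -> 'rV[R]_n) (t : nat -> R),
    [/\ forall k, X (x k) /\ x k != 0,
        x k @[k --> \oo] --> (0 : 'rV[R]_n),
        forall k, 0 < t k
      & t k *: x k @[k --> \oo] --> v]].

Definition C1_equation {R : realType} (X : set 'rV[R]_3) (p : 'rV[R]_3)
    (g : 'rV[R]_3 -> R) : Prop :=
  [/\ \forall q \near p, differentiable g q /\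
        forall v, {for q, continuous (fun z => 'd g z v)},
      exists v, 'd g p v != 0
    & \forall q \near p, X q <-> g q = 0].

Definition C1_surface_at {R : realType} (X : set 'rV[R]_3) (p : 'rV[R]_3) :
    Prop :=
  X p /\ exists g, C1_equation X p g.

(* The Grassmannian of 2-planes of R^3, a plane being encoded by its
   orthogonal projection v |-> v *m P; the topology induced by 'M[R]_3 is the
   usual one. *)
Definition planes {R : realType} : set 'M[R]_3 :=
  [set P | [/\ P^T = P, P *m P = P & \rank P = 2%N]].

Definition tangent_plane {R : realType} (X : set 'rV[R]_3) (p : 'rV[R]_3)
    (P : 'M[R]_3) : Prop :=
  [/\ X p, planes P
    & exists2 g, C1_equation X p g & forall v, v *m P = v <-> 'd g p v = 0].

(* Rays from the origin are encoded by their unit direction vector u. *)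
Definition nash_fiber {R : realType} (X : set 'rV[R]_3) (u : 'rV[R]_3) :
    set 'M[R]_3 :=
  [set P | planes P /\
    exists (x : nat -> 'rV[R]_3) (T : nat -> 'M[R]_3),
      [/\ forall k, x k != 0 /\ tangent_plane X (x k) (T k),
          x k @[k --> \oo] --> (0 : 'rV[R]_3),
          (enorm (x k))^-1 *: x k @[k --> \oo] --> u
        & T k @[k --> \oo] --> P]].

Definition unit_cube {R : realType} {d} : set 'rV[R]_d :=
  [set x | forall i, 0 <= x 0 i <= 1].

(* On compact cubes a continuous injection is an embedding.  For semialgebraic
   sets, such as the fibers above, dim_eq is the semialgebraic dimension. *)
Definition contains_cube (R : realType) {T : topologicalType} (S : set T)
    (d : nat) : Prop :=
  exists g : 'rV[R]_d -> T,
    [/\ {within unit_cube, continuous g},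
        set_inj unit_cube g
      & g @` unit_cube `<=` S].

Definition dim_eq (R : realType) {T : topologicalType} (S : set T) (d : nat) :
    Prop :=
  contains_cube R S d /\ forall e, (d < e)%N -> ~ contains_cube R S e.

Definition exceptional {R : realType} (X : set 'rV[R]_3) (u : 'rV[R]_3) :
    Prop :=
  [/\ enorm u = 1, tangent_cone X u,
      connected (nash_fiber X u), closed (nash_fiber X u)
    & dim_eq R (nash_fiber X u) 1].

Definition wedge {R : realType} (m eps : R) : set 'rV[R]_2 :=
  [set q | 0 <= ycoord q <= eps /\ `|xcoord q| <= m * ycoord q].

(* convergent Puiseux expansion on [0, eps]; the bounds -my <= r <= my put on
   the arcs of a piece rule out negative exponents *)
Definition analytic_arc {R : realType} (eps : R) (r : R -> R) : Prop :=
  exists (N : nat) (a : nat -> R), (0 < N)%N /\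
    forall y, 0 <= y <= eps -> pseries a (y `^ N%:R^-1) @ \oo --> r y.

Definition region {R : realType} (eps : R) (r1 r2 : R -> R) : set 'rV[R]_2 :=
  [set q | 0 <= ycoord q <= eps /\
           r1 (ycoord q) <= xcoord q <= r2 (ycoord q)].

(* Pieces are given by the data f, eps, r1, r2 that define them: the piece
   itself is graph f (region eps r1 r2). *)
Definition piece {R : realType} (f : 'rV[R]_2 -> R) (m eps : R)
    (r1 r2 : R -> R) : Prop :=
  [/\ analytic_arc eps r1, analytic_arc eps r2,
      forall y, 0 < y <= eps ->
        [/\ - (m * y) <= r1 y, r1 y < r2 y & r2 y <= m * y]
    & semialgebraic (graph f (region eps r1 r2))].

Definition is_unit {R : realType} (u : R -> R) : Prop :=
  exists2 l : R, l != 0 & u y @[y --> 0^'+] --> l.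

Definition order_inv {R : realType} (eps : R) (g : R -> R) (w : rat) : Prop :=
  0 < w /\ exists2 u, is_unit u &
    forall y, 0 < y <= eps -> g y = y `^ ratr w^-1 * u y.

Definition is_width {R : realType} (eps : R) (r1 r2 : R -> R) (w : rat) :
    Prop :=
  order_inv eps (fun y => `|r2 y - r1 y|) w.

Definition is_height {R : realType} (f : 'rV[R]_2 -> R) (eps : R)
    (r1 r2 : R -> R) (h : rat) : Prop :=
  exists xmax xmin : R -> R,
    [/\ analytic_arc eps xmax, analytic_arc eps xmin,
        forall y, 0 < y <= eps ->
          [/\ r1 y <= xmax y <= r2 y, r1 y <= xmin y <= r2 y
            & forall x, r1 y <= x <= r2 y ->
                f (vec2 (xmin y) y) <= f (vec2 x y) <= f (vec2 (xmax y) y)]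
      & order_inv eps
          (fun y => `|f (vec2 (xmax y) y) - f (vec2 (xmin y) y)|) h].

(* f_x with values in \bar R: the difference quotient of f in x tends to
   +oo or -oo at points where V has a vertical tangent plane. *)
Definition x_quotient {R : realType} (f : 'rV[R]_2 -> R) (q : 'rV[R]_2)
    (t : R) : \bar R :=
  ((f (vec2 (xcoord q + t) (ycoord q)) - f q) / t)%:E.

Definition has_fx {R : realType} (f : 'rV[R]_2 -> R) (q : 'rV[R]_2) : Prop :=
  cvg (x_quotient f q t @[t --> 0^']).

Definition fx {R : realType} (f : 'rV[R]_2 -> R) (q : 'rV[R]_2) : \bar R :=
  lim (x_quotient f q t @[t --> 0^']).

(* The origin is left out: V may be singular there, and when the tangent cone
   of V is horizontal f_x vanishes there, so that no piece would be FI or FD. *)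
Definition punctured_region {R : realType} (eps : R) (r1 r2 : R -> R) :
    set 'rV[R]_2 :=
  region eps r1 r2 `\ 0.

Definition FL {R : realType} (f : 'rV[R]_2 -> R) (eps : R) (r1 r2 : R -> R) :
    Prop :=
  exists2 K : R, 0 < K & forall q, punctured_region eps r1 r2 q ->
    has_fx f q /\ (`|fx f q| <= K%:E)%E.

Definition FI {R : realType} (f : 'rV[R]_2 -> R) (eps : R) (r1 r2 : R -> R) :
    Prop :=
  (exists2 K : R, 0 < K & forall q, punctured_region eps r1 r2 q ->
     has_fx f q /\ (K%:E <= fx f q)%E) /\
  (exists r3 : R -> R,
     [/\ analytic_arc eps r3,
         forall y, 0 <= y <= eps -> r1 y <= r3 y <= r2 y
       & (forall y, 0 < y < eps -> fx f (vec2 (r3 y) y) = +oo%E) \/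
         fx f (vec2 (r3 y) y) @[y --> 0^'+] --> +oo%E]).

Definition FD {R : realType} (f : 'rV[R]_2 -> R) (eps : R) (r1 r2 : R -> R) :
    Prop :=
  (exists2 K : R, 0 < K & forall q, punctured_region eps r1 r2 q ->
     has_fx f q /\ (fx f q <= (- K)%:E)%E) /\
  (exists r3 : R -> R,
     [/\ analytic_arc eps r3,
         forall y, 0 <= y <= eps -> r1 y <= r3 y <= r2 y
       & (forall y, 0 < y < eps -> fx f (vec2 (r3 y) y) = -oo%E) \/
         fx f (vec2 (r3 y) y) @[y --> 0^'+] --> -oo%E]).

Definition union_of_pieces {R : realType} (f : 'rV[R]_2 -> R) (m eps : R)
    (Q : (R -> R) -> (R -> R) -> Prop) (r1 r2 : R -> R) : Prop :=
  exists (n : nat) (s : nat -> R -> R),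
    [/\ (0 < n)%N, s 0%N = r1, s n = r2
      & forall i, (i < n)%N ->
          piece f m eps (s i) (s i.+1) /\ Q (s i) (s i.+1)].

Definition NFI {R : realType} (f : 'rV[R]_2 -> R) (m eps : R)
    (r1 r2 : R -> R) : Prop :=
  union_of_pieces f m eps (fun a b => FL f eps a b \/ FD f eps a b) r1 r2.

Definition NFD {R : realType} (f : 'rV[R]_2 -> R) (m eps : R)
    (r1 r2 : R -> R) : Prop :=
  union_of_pieces f m eps (fun a b => FL f eps a b \/ FI f eps a b) r1 r2.

Definition analytic_on {R : realType} {n} (g : R -> 'rV[R]_n) (a b : R) :
    Prop :=
  forall t0, a <= t0 <= b ->
    exists (c : nat -> 'rV[R]_n) (d : R), 0 < d /\
      forall t, a <= t <= b -> `|t - t0| < d ->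
        series (fun k => (t - t0) ^+ k *: c k) @ \oo --> g t.

Definition piecewise_analytic {R : realType} {n} (g : R -> 'rV[R]_n)
    (a b : R) : Prop :=
  exists2 s : seq R, itv_partition a b s &
    forall i, (i < size s)%N ->
      analytic_on g (nth b (a :: s) i) (nth b (a :: s) i.+1).

Definition polygon_length {R : realType} {n} (g : R -> 'rV[R]_n) (a b : R)
    (s : seq R) : R :=
  \sum_(0 <= i < size s)
    enorm (g (nth b (a :: s) i.+1) - g (nth b (a :: s) i)).

Definition arc_length {R : realType} {n} (g : R -> 'rV[R]_n) (a b : R) :
    \bar R :=
  ereal_sup [set (polygon_length g a b s)%:E | s in itv_partition a b].

Definition joins {R : realType} {n} (X : set 'rV[R]_n) (p q : 'rV[R]_n)
    (g : R -> 'rV[R]_n) : Prop :=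
  [/\ piecewise_analytic g 0 1, g 0 = p, g 1 = q
    & forall t, 0 <= t <= 1 -> X (g t)].

Definition inner_dist {R : realType} {n} (X : set 'rV[R]_n)
    (p q : 'rV[R]_n) : \bar R :=
  ereal_inf [set arc_length g 0 1 | g in joins X p q].

Definition outer_dist {R : realType} {n} (p q : 'rV[R]_n) : R := enorm (p - q).

Definition l_regular {R : realType} {n} (X : set 'rV[R]_n) : Prop :=
  exists2 A : set 'rV[R]_n, nbhs (0 : 'rV[R]_n) A & exists2 K : R, 0 < K &
    forall p q, (X `&` A) p -> (X `&` A) q ->
      (inner_dist X p q <= (K * outer_dist p q)%:E)%E.

Definition nbhd0_in {R : realType} {n} (X A : set 'rV[R]_n) : Prop :=
  A `<=` X /\ within X (nbhs (0 : 'rV[R]_n)) A.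

Definition bilipschitz_homeo {R : realType} {n k} (A : set 'rV[R]_n)
    (B : set 'rV[R]_k) (phi : 'rV[R]_n -> 'rV[R]_k) : Prop :=
  set_bij A B phi /\
  exists2 K : R, 0 < K & forall p q, A p -> A q ->
    K^-1 * outer_dist p q <= outer_dist (phi p) (phi q) <= K * outer_dist p q.

Definition bilipschitz_germs {R : realType} {n k} (X : set 'rV[R]_n)
    (Y : set 'rV[R]_k) : Prop :=
  exists (A : set 'rV[R]_n) (B : set 'rV[R]_k) (phi : 'rV[R]_n -> 'rV[R]_k),
    [/\ nbhd0_in X A, nbhd0_in Y B, phi 0 = 0 & bilipschitz_homeo A B phi].

(* Main.v *)
Require Import Defs.
From mathcomp Require Import all_boot all_order all_algebra.
From mathcomp Require Import all_classical all_reals all_analysis.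
From mathcomp Require Import ring lra.
Import Order.TTheory GRing.Theory Num.Theory.
Import numFieldNormedType.Exports.
Local Open Scope classical_set_scope.
Local Open Scope ring_scope.

Set Implicit Arguments.
Unset Strict Implicit.
Unset Printing Implicit Defensive.

(* Up to the sign of [f], the slice of [f] at height [y] over [r0 y, r3 y] is
   a valley of width [y `^ (1 / w)] and depth at least a multiple of
   [y `^ (1 / min h1 h3)], which is much larger than the width; the bottom is
   within a multiple of the width of [f (r1 y, y)].  Take two points at equal
   height on the two walls, halfway up; their distance is at most the width.  A
   path joining them that stays within a multiple of this distance has to cross
   the curve [x = r1 y'] at some [y'] close to [y], where [f] is still near the
   bottom, so it descends much further than it is allowed to.

   That the bottom [f (r1 y', y')] does not rise quickly near [y] is needed only
   for suitable arbitrarily small [y], and [f = O(y)] on the wedge is enough to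
   find them: no regularity theory for semialgebraic functions is used.  The
   crossing argument takes place on [V] rather than on the piece, so it also
   applies to the preimage of a segment under a bilipschitz chart. *)

(** * Continuity and growth of a graph that is a surface *)

Section Graph.
Variable R : realType.
Implicit Types (x y z : R).

(** A positive product encodes having the same sign; multiplying the two products leaves [a * c]
    times the positive square of [b]. *)
Lemma mulr_gt0_trans (a b c : R) : 0 < a * b -> 0 < b * c -> 0 < a * c.
Proof.
move=> ab bc; have b0 : b != 0 by apply/eqP => b0; rewrite b0 mulr0 ltxx in ab.
have b2 : 0 < b * b by rewrite -expr2 exprn_even_gt0.
rewrite -(pmulr_lgt0 _ b2) (_ : a * c * (b * b) = (a * b) * (b * c)); last by ring.
exact: mulr_gt0.
Qed.

(* Replaces invariance of domain: the fiber of [G] over [q0] vanishes only at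
   [f q0]; if it had the same sign on both sides, then a nearby fiber, at a point
   where [G] has the opposite sign, would have two zeros. *)
Lemma continuous_of_zero_set (T : topologicalType) (f : T -> R)
    (G : T * R -> R) (q0 : T) :
  (\forall u \near (q0, f q0), {for u, continuous G}) ->
  (\forall u \near (q0, f q0), G u = 0 <-> f u.1 = u.2) ->
  (forall N, nbhs (q0, f q0) N ->
     (exists2 u, N u & G u < 0) /\ (exists2 u, N u & 0 < G u)) ->
  {for q0, continuous f}.
Proof.
set z0 := f q0 => Gcont Gzero Gsign.
have [[/= A B] [/= nA nB] AB] := filterI Gcont Gzero.
have /nbhs_ballP[d0 /= d0_gt0 dB] := nB.
have {}AB q z : A q -> `|z - z0| < d0 ->
    {for (q, z), continuous G} /\ (G (q, z) = 0 <-> f q = z).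
  move=> Aq zd; apply: (AB (q, z)); split => //=; apply: dB.
  by rewrite /ball /= distrC.
(* A sign change of [G] on the fiber over [q] yields a zero there, and the only possible zero is
   [f q]; this is how values of [f] get trapped. *)
have zero q a b : A q -> `|a - z0| < d0 -> `|b - z0| < d0 -> a <= b ->
    G (q, a) * G (q, b) <= 0 -> a <= f q <= b.
  move=> Aq ad bd ab Gab.
  have itvd z : a <= z <= b -> `|z - z0| < d0.
    move=> /andP[az zb]; move: ad bd; rewrite !ltr_distl => /andP[? ?] /andP[? ?].
    by apply/andP; split; lra.
  have [||c] := @IVT R (fun z => G (q, z)) a b 0 ab.
  - apply/subspace_continuousP => z; rewrite /= in_itv/= => zab.
    apply: cvg_within_filter; apply: (@continuous_comp _ _ _ (fun z => (q, z)) G).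
      by apply: (@cvg_pair _ _ _ _ (nbhs q) (nbhs z)); [exact: cvg_cst|exact: cvg_id].
    exact: (AB _ _ Aq (itvd _ zab)).1.
  - rewrite ge_min le_max; apply/andP; split; apply/orP.
      have [Ga|Ga] := leP (G (q, a)) 0; [by left|right].
      by rewrite leNgt; apply/negP => Gb; rewrite leNgt mulr_gt0 in Gab.
    have [Ga|Ga] := leP 0 (G (q, a)); [by left|right].
    by rewrite leNgt; apply/negP => Gb; rewrite leNgt nmulr_rgt0 ?Gb in Gab.
  rewrite in_itv/= => cab Gc.
  by have [_ [/(_ Gc) ->]] := AB _ _ Aq (itvd _ cab).
apply/cvgrPdist_le => e e0.
pose d := Num.min e (d0 / 2).
have d_gt0 : 0 < d by rewrite lt_min e0/= divr_gt0.
have d_lt : d < d0.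
  have : d <= d0 / 2 by rewrite ge_min lexx orbT.
  by lra.
have Aq0 : A q0 by exact: nbhs_singleton.
have dm : `|z0 - d - z0| < d0 by rewrite addrAC subrr sub0r normrN gtr0_norm.
have dp : `|z0 + d - z0| < d0 by rewrite addrAC subrr add0r gtr0_norm.
(* Off [z0] the function [G (q0, _)] does not vanish, so its sign at a fixed [z] persists on the
   fibers over nearby [q]. *)
have sgn z : `|z - z0| < d0 -> z != z0 ->
    \forall q \near q0, 0 < G (q, z) * G (q0, z).
  move=> zd zz0; have [Gc Gz] := AB _ _ Aq0 zd.
  have Gn0 : G (q0, z) != 0 by apply/eqP => /Gz /esym/eqP; rewrite (negPf zz0).
  have : (fun q => G (q, z) * G (q0, z)) @ q0 --> G (q0, z) * G (q0, z).
    apply: cvgM; last exact: cvg_cst.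
    apply: (@continuous_comp _ _ _ (fun q => (q, z)) G) => //.
    by apply: (@cvg_pair _ _ _ _ (nbhs q0) (nbhs z)); [exact: cvg_id|exact: cvg_cst].
  by move/cvgr_gt; apply; rewrite -expr2 exprn_even_gt0.
have nm := sgn _ dm; have np := sgn _ dp.
have {}nm := nm _; have {}np := np _.
have /nm{}nm : z0 - d != z0 by rewrite -subr_eq0 addrAC subrr sub0r oppr_eq0 gt_eqF.
have /np{}np : z0 + d != z0 by rewrite -subr_eq0 addrAC subrr add0r gt_eqF.
(* Opposite signs at [z0 - d] and [z0 + d] persist nearby and trap [f q] between them. Equal signs
   are to be refuted. *)
have [Gprod|Gprod] := ltP 0 (G (q0, z0 - d) * G (q0, z0 + d)); last first.
  near=> q.
  have Aq : A q by near: q.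
  have : z0 - d <= f q <= z0 + d.
    apply: zero => //.
      by rewrite lerD2l (le_trans _ (ltW d_gt0))// oppr_le0 ltW.
    have pm : 0 < G (q, z0 - d) * G (q0, z0 - d) by near: q.
    have pp : 0 < G (q, z0 + d) * G (q0, z0 + d) by near: q.
    have := mulr_gt0 pm pp; rewrite mulrACA => h.
    by rewrite leNgt; apply/negP => h2; rewrite pmulr_rgt0// ltNge Gprod in h.
  rewrite -/z0 -ler_distlC => /le_trans; apply.
  by rewrite ge_min lexx.
pose N := [set u : T * R | [/\ A u.1, `|u.2 - z0| < d,
   0 < G (u.1, z0 - d) * G (q0, z0 - d) &
   0 < G (u.1, z0 + d) * G (q0, z0 + d)]].
have nN : nbhs (q0, z0) N.
  exists ([set q | [/\ A q, 0 < G (q, z0 - d) * G (q0, z0 - d) &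
   0 < G (q, z0 + d) * G (q0, z0 + d)]], ball z0 d) => /=.
    split => /=; last exact: nbhsx_ballx.
    by near=> q; split; near: q.
  by move=> [q z]/= [[? ? ?] zd]; split => //=; rewrite distrC.
have {nN}[[[q z] [/= Aq zd Gm Gp] Gneg] [[q' z'] [/= Aq' zd' Gm' Gp'] Gpos]] :=
  Gsign N nN.
(* If [G (q1, z1)] has the sign opposite to both ends of its fiber, there is a zero on each side of
   [z1]. Both equal [f q1], hence [z1], where [G] would then vanish. *)
have bad q1 z1 : A q1 -> `|z1 - z0| < d ->
   0 < G (q1, z0 - d) * G (q0, z0 - d) ->
   0 < G (q1, z0 + d) * G (q0, z0 + d) ->
   G (q1, z1) * G (q0, z0 - d) < 0 -> False.
  move=> {Gm Gp Gm' Gp'} Aq1 z1d Gm Gp Gneg'.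
  have z1d0 := lt_trans z1d d_lt.
  have [_ [_ Gz1]] := AB _ _ Aq1 z1d0.
  have := z1d; rewrite ltr_distl => /andP[z1l z1r].
  have bA : 0 < G (q0, z0 - d) * - G (q1, z1) by rewrite mulrN oppr_gt0 mulrC.
  have ab := mulr_gt0_trans Gm bA.
  have cA : 0 < G (q1, z0 + d) * G (q0, z0 - d).
    by apply: mulr_gt0_trans Gp _; rewrite mulrC.
  have cb := mulr_gt0_trans cA bA.
  have : G (q1, z1) = 0.
    apply: Gz1; apply/eqP; rewrite eq_le.
    have /andP[_ ->] : z0 - d <= f q1 <= z1.
      by apply: zero => //; lra.
    have /andP[-> _] : z1 <= f q1 <= z0 + d by apply: zero => //; lra.
    by [].
  by move=> G0; move: Gneg'; rewrite G0 mul0r ltxx.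
have [s|s|s] := ltgtP (G (q0, z0 - d)) 0.
- by exfalso; apply: (bad q' z') => //; rewrite pmulr_rlt0.
- by exfalso; apply: (bad q z) => //; rewrite pmulr_llt0.
- by move: Gprod; rewrite s mul0r ltxx.
Unshelve. all: by end_near.
Qed.

Lemma xcoord_vec2 x y : xcoord (vec2 x y) = x.
Proof. by rewrite /xcoord mxE. Qed.
Lemma ycoord_vec2 x y : ycoord (vec2 x y) = y.
Proof. by rewrite /ycoord mxE inordK. Qed.
Lemma xcoord_vec3 x y z : xcoord (vec3 x y z) = x.
Proof. by rewrite /xcoord mxE. Qed.
Lemma ycoord_vec3 x y z : ycoord (vec3 x y z) = y.
Proof. by rewrite /ycoord mxE inordK. Qed.
Lemma zcoord_vec3 x y z : zcoord (vec3 x y z) = z.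
Proof. by rewrite /zcoord mxE inordK. Qed.
Definition vec3E := (xcoord_vec3, ycoord_vec3, zcoord_vec3).
Definition vec2E := (xcoord_vec2, ycoord_vec2).

Lemma vec2_coords (q : 'rV[R]_2) : vec2 (xcoord q) (ycoord q) = q.
Proof.
apply/rowP => i; rewrite mxE.
by case: i => [[|[|//]]] i2 /=; congr (q _ _); apply/val_inj => //=; rewrite inordK.
Qed.

Lemma vec3_coords (p : 'rV[R]_3) : vec3 (xcoord p) (ycoord p) (zcoord p) = p.
Proof.
apply/rowP => i; rewrite mxE.
by case: i => [[|[|[|//]]]] i2 /=; congr (p _ _); apply/val_inj => //=; rewrite inordK.
Qed.

Lemma vec3D x y z x' y' z' :
  vec3 x y z + vec3 x' y' z' = vec3 (x + x') (y + y') (z + z').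
Proof. by apply/rowP => -[[|[|[|//]]] i3]; rewrite !mxE. Qed.

Lemma vec3Z a x y z : a *: vec3 x y z = vec3 (a * x) (a * y) (a * z).
Proof. by apply/rowP => -[[|[|[|//]]] i3]; rewrite !mxE. Qed.

Lemma vec2Z a x y : a *: vec2 x y = vec2 (a * x) (a * y).
Proof. by apply/rowP => -[[|[|//]] i3]; rewrite !mxE. Qed.
Lemma vec2D x y x' y' :
  vec2 x y + vec2 x' y' = vec2 (x + x') (y + y').
Proof. by apply/rowP => -[[|[|//]] i3]; rewrite !mxE. Qed.

Lemma vec3_continuous :
  continuous (fun u : (R * R) * R => vec3 u.1.1 u.1.2 u.2).
Proof.
move=> u /=.
have E : (fun u : (R * R) * R => vec3 u.1.1 u.1.2 u.2) =
    (fun u => u.1.1 *: vec3 1 0 0 + u.1.2 *: vec3 0 1 0 + u.2 *: vec3 0 0 1).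
  by apply/funext => v; rewrite !vec3Z !vec3D; congr vec3; lra.
rewrite E; apply: cvgD; [apply: cvgD|]; apply: cvgZr_tmp.
- by apply: (@continuous_comp _ _ _ fst fst); exact: cvg_fst.
- by apply: (@continuous_comp _ _ _ fst snd); [exact: cvg_fst|exact: cvg_snd].
- exact: cvg_snd.
Qed.

Lemma vec2_continuous : continuous (fun u : R * R => vec2 u.1 u.2).
Proof.
move=> u /=.
have E : (fun u : R * R => vec2 u.1 u.2) =
    (fun u => u.1 *: vec2 1 0 + u.2 *: vec2 0 1).
  by apply/funext => v; rewrite !vec2Z !vec2D; congr vec2; lra.
by rewrite E; apply: cvgD; apply: cvgZr_tmp; [exact: cvg_fst|exact: cvg_snd].
Qed.

Lemma graph_vec3 (f : 'rV[R]_2 -> R) D x y z :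
  graph f D (vec3 x y z) <-> D (vec2 x y) /\ f (vec2 x y) = z.
Proof.
split=> [[q Dq E]|[Dxy <-]]; last by exists (vec2 x y); rewrite ?vec2E.
move: (congr1 xcoord E) (congr1 ycoord E) (congr1 zcoord E).
by rewrite !vec3E => <- <- <-; rewrite vec2_coords.
Qed.

(** Since [g p = 0], the quotient [g (p + t *: v) / t] tends to the nonzero derivative along [v], so
    [g] changes sign at [p] along this line. *)
Lemma C1_equation_sign (X : set 'rV[R]_3) p g : X p -> C1_equation X p g ->
  exists2 v, 'd g p v != 0 & \forall t \near 0^', 0 < t * g (p + t *: v) * 'd g p v.
Proof.
move=> Xp [/nbhs_singleton[dg _] [v dv] /nbhs_singleton Xg].
exists v => //.
have gp0 : g p = 0 by apply/Xg.
have : (fun t => t^-1 *: (g (t *: v + p) - g p) * 'd g p v) @ 0^' -->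
    'd g p v * 'd g p v.
  apply: cvgM; last exact: cvg_cst.
  by rewrite -(deriveE v dg); exact: diff_derivable.
have dv2 : 0 < 'd g p v * 'd g p v by rewrite -expr2 exprn_even_gt0.
move=> /cvgr_gt/(_ _ dv2) H.
near=> t.
have t0 : t != 0 by near: t; exact: nbhs_dnbhs_neq.
have : 0 < t^-1 *: (g (t *: v + p) - g p) * 'd g p v by near: t.
have t2 : 0 < t * t by rewrite -expr2 exprn_even_gt0.
rewrite gp0 subr0 (addrC p) => h.
rewrite (_ : _ * _ = t * t * (t^-1 * g (t *: v + p) * 'd g p v)); last by field.
exact: mulr_gt0.
Unshelve. all: by end_near.
Qed.

(** The tangent plane may be vertical, so the equation cannot be solved for [z] by the implicit
    function theorem. The sign change of [g] along some line through the point suffices instead. *)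
Lemma C1_graph_continuous (U : set 'rV[R]_2) (f : 'rV[R]_2 -> R) x y :
  nbhs (vec2 x y) U -> C1_surface_at (graph f U) (vec3 x y (f (vec2 x y))) ->
  {for (x, y), continuous (fun u : R * R => f (vec2 u.1 u.2))}.
Proof.
move=> nU [Xp [g gX]]; set p := vec3 _ _ _ in Xp gX.
pose G (u : (R * R) * R) := g (vec3 u.1.1 u.1.2 u.2).
have v3 := @vec3_continuous ((x, y), f (vec2 x y)).
have [gd _ gz] := gX.
apply: (continuous_of_zero_set (f := fun u : R * R => f (vec2 u.1 u.2)) (G := G)).
- have gd' : \forall q \near p, differentiable g q by apply: filterS gd => q [].
  near=> u; have du : differentiable g (vec3 u.1.1 u.1.2 u.2).
    by near: u; exact: (v3 _ gd').
  apply: continuous_comp; first exact: vec3_continuous.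
  exact: differentiable_continuous.
- have nU' : \forall u \near ((x, y), f (vec2 x y)), U (vec2 u.1.1 u.1.2).
    have v2 : {for ((x, y), f (vec2 x y)),
        continuous (fun u : (R * R) * R => vec2 u.1.1 u.1.2)}.
      apply: (@continuous_comp _ _ _ (fun u : (R * R) * R => u.1)
        (fun u => vec2 u.1 u.2)); first exact: cvg_fst.
      exact: vec2_continuous.
    exact: v2 _ nU.
  near=> u; rewrite /G.
  have <- : graph f U (vec3 u.1.1 u.1.2 u.2) <-> g (vec3 u.1.1 u.1.2 u.2) = 0.
    by near: u; exact: (v3 _ gz).
  have Uu : U (vec2 u.1.1 u.1.2) by near: u.
  by rewrite graph_vec3; tauto.
- move=> N nN.
  have [v dv sv] := C1_equation_sign Xp gX.
  pose c t := ((x + t * xcoord v, y + t * ycoord v),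
               f (vec2 x y) + t * zcoord v).
  have cp t : G (c t) = g (p + t *: v).
    by rewrite /G /c /p -[v in RHS]vec3_coords vec3Z vec3D.
  have lin a b : (fun t : R => a + t * b) @ 0 --> a.
    rewrite -[X in _ --> X]addr0; apply: cvgD; first exact: cvg_cst.
    by rewrite -[X in _ --> X](mul0r b); apply: cvgM; [exact: cvg_id|exact: cvg_cst].
  have cN : \forall t \near 0, N (c t).
    have cc : c t @[t --> 0] --> ((x, y), f (vec2 x y)).
      apply: (@cvg_pair _ _ _ (nbhs 0) (nbhs (x, y)) (nbhs (f (vec2 x y))));
        last exact: lin.
      by apply: (@cvg_pair _ _ _ (nbhs 0) (nbhs x) (nbhs y)); exact: lin.
    exact: cc _ nN.
  have both s : s != 0 -> exists2 u, N u & 0 < s * G u.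
    move=> s0.
    have [/nbhs_ballP[e1 /= e10 b1] /nbhs_ballP[e2 /= e20 b2]] := (cN, sv).
    pose e := Num.min e1 e2 / 2.
    have e0 : 0 < e by rewrite divr_gt0// lt_min e10.
    have el : e < Num.min e1 e2 by move: e0; rewrite /e; lra.
    have [ee1 ee2] : e < e1 /\ e < e2 by move: el; rewrite lt_min => /andP[].
    (* The side of [p] on the line is chosen so that [g] gets the sign of [s] there. *)
    pose t := Num.sg (s * 'd g p v) * e.
    have sd : s * 'd g p v != 0 by rewrite mulf_neq0.
    have te : `|t| = e by rewrite /t normrM normr_sg sd mul1r gtr0_norm.
    exists (c t).
      by apply: b1; rewrite /ball/= sub0r normrN te.
    rewrite cp.
    have := b2 t; rewrite /ball/= sub0r normrN te => /(_ ee2).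
    have t0 : t != 0 by rewrite -normr_eq0 te gt_eqF.
    move=> /(_ t0) h.
    have st : 0 < t * (s * 'd g p v).
      by rewrite /t mulrAC -normrEsg mulr_gt0// normr_gt0.
    have := mulr_gt0 h st.
    have -> : t * g (p + t *: v) * 'd g p v * (t * (s * 'd g p v)) =
      (t * 'd g p v) ^+ 2 * (s * g (p + t *: v)) by ring.
    by rewrite pmulr_rgt0// exprn_even_gt0//= mulf_neq0.
  split.
    have [|u Nu] := both (-1); first by rewrite oppr_eq0 oner_eq0.
    by rewrite mulN1r oppr_gt0; exists u.
  by have [|u Nu] := both 1; rewrite ?oner_eq0 ?mul1r//; exists u.
Unshelve. all: by end_near.
Qed.

(** * Linear growth of [f] from a horizontal tangent cone *)

Lemma coord_norm n (v : 'rV[R]_n) i : `|v 0 i| <= `|v|.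
Proof.
rewrite [leRHS]/Num.norm /= mx_normrE.
by apply/bigmax_geP; right => /=; exists (0, i).
Qed.

Lemma cvg_harmonic n (u : nat -> 'rV[R]_n) v :
  (forall k, `|u k - v| < k.+1%:R^-1) -> u @ \oo --> v.
Proof.
move=> uv; apply/cvgrPdist_lt => e e0.
near=> k; rewrite distrC (lt_trans (uv k))//.
near: k; exact: (@near_infty_natSinv_lt R (PosNum e0)).
Unshelve. all: by end_near.
Qed.

(** Otherwise some points [q k] tending to [0] have [|q k| < |f (q k)|]. Dividing the graph points
    by [|f (q k)|] keeps them in a cube with last coordinate 1 or -1, and a cluster point is a
    non-horizontal vector of the cone. *)
Lemma tangent_cone_horizontal (U : set 'rV[R]_2) (f : 'rV[R]_2 -> R) :
  nbhs (0 : 'rV[R]_2) U -> {for (0 : 'rV[R]_2), continuous f} -> f 0 = 0 ->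
  tangent_cone (graph f U) `<=` [set v | zcoord v = 0] ->
  \forall q \near (0 : 'rV[R]_2), `|f q| <= `|q|.
Proof.
move=> nU cf f0 cone; apply: contrapT => nH.
have /choice[q qP] k : exists q, [/\ `|q| < k.+1%:R^-1, U q & `|q| < `|f q|].
  apply: contrapT => nq; apply: nH.
  near=> q; rewrite leNgt; apply/negP => fq; apply: nq; exists q; split => //.
  by near: q.
pose p k := vec3 (xcoord (q k)) (ycoord (q k)) (f (q k)).
pose t k := `|f (q k)|^-1.
have fq0 k : 0 < `|f (q k)| by have [_ _ /le_lt_trans->] := qP k.
have t0 k : 0 < t k by rewrite invr_gt0.
have tz k : `|t k * f (q k)| = 1.
  by rewrite normrM gtr0_norm// mulVf// gt_eqF.
have q0 : q @ \oo --> (0 : 'rV[R]_2).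
  by apply: cvg_harmonic => k; rewrite subr0; have [] := qP k.
have p0 : p @ \oo --> (0 : 'rV[R]_3).
  have -> : 0 = vec3 0 0 0 :> 'rV[R]_3.
    by apply/rowP => -[[|[|[|//]]] i3]; rewrite !mxE.
  have c0 (i : 'I_2) : q k 0 i @[k --> \oo] --> (0 : R).
    have -> : 0 = (0 : 'rV[R]_2) 0 i by rewrite mxE.
    by apply: (cvg_comp q (fun v : 'rV[R]_2 => v 0 i) q0); exact: coord_continuous.
  have fc : f (q k) @[k --> \oo] --> (0 : R).
    by rewrite -f0; apply: (cvg_comp q f q0); exact: cf.
  have h : ((xcoord (q k), ycoord (q k)), f (q k)) @[k --> \oo] -->
      ((0 : R, 0 : R), 0 : R).
    apply: (@cvg_pair _ _ _ _ (nbhs (0 : R, 0 : R)) (nbhs (0 : R))) => //.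
    by apply: (@cvg_pair _ _ _ _ (nbhs (0 : R)) (nbhs (0 : R))); exact: c0.
  exact: (cvg_comp _ _ h (@vec3_continuous ((0, 0), 0))).
pose C := [set v : 'rV[R]_3 | forall i, v 0 i \in `[(-1 : R), 1]].
have Cc : compact C.
  apply: (@rV_compact _ _ (fun=> `[(-1 : R), 1]%classic)).
  by move=> _; apply: segment_compact.
have wC k : C (t k *: p k).
  move=> i; rewrite in_itv/= -ler_norml mxE /p mxE.
  case: i => [[|[|[|//]]] i3] /=; rewrite ?tz// normrM (gtr0_norm (t0 k)).
    rewrite /t ler_pdivrMl// mulr1; have [_ _ /ltW] := qP k.
    by apply: le_trans; exact: coord_norm.
  rewrite /t ler_pdivrMl// mulr1; have [_ _ /ltW] := qP k.
  by apply: le_trans; exact: coord_norm.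
have [|v [Cv vP]] := Cc ((fun k => t k *: p k) @ \oo) _.
  by exists 0%N => // k _; exact: wC.
(* The indices [n k] need not increase: [k <= n k] already makes [p (n k)] tend to [0]. *)
have /choice[n nP] k : exists n, (k <= n)%N /\ `|t n *: p n - v| < k.+1%:R^-1.
  have [||w [[n /= kn <-]]] := vP [set t n *: p n | n in [set n | (k <= n)%N]]
      (ball v k.+1%:R^-1).
  - by exists k => // n /= kn; exists n.
  - exact: nbhsx_ballx.
  by rewrite -ball_normE /= distrC; exists n.
have nv : t (n k) *: p (n k) @[k --> \oo] --> v.
  by apply: cvg_harmonic => k; have [] := nP k.
have : zcoord v = 0.
  apply: cone; exists (p \o n), (t \o n); split => //=.
  - move=> k; split; first by exists (q (n k)) => //; have [] := qP (n k).
    apply/eqP => /(congr1 zcoord); rewrite vec3E /zcoord mxE => /eqP.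
    by rewrite -normr_eq0 gt_eqF.
  - apply: (cvg_comp n p) p0 => A [N _ NA]; exists N => // k /= Nk.
    by apply: NA => /=; apply: leq_trans Nk _; have [] := nP k.
have zc : zcoord (t (n k) *: p (n k)) @[k --> \oo] --> zcoord v.
  by apply: (cvg_comp _ _ nv); exact: coord_continuous.
move=> v0; move: zc; rewrite v0 => /cvgrPdist_lt/(_ 1 ltr01)[N _ /(_ N (leqnn N))].
by rewrite /= sub0r normrN vec3Z vec3E tz ltxx.
Unshelve. all: by end_near.
Qed.

End Graph.

(** * The valley *)

Section Valley.
Variable R : realType.
Implicit Types (x y z : R).

(* Continuity of [g] is not implied: an infinite slope allows a jump. *)
Lemma local_decr_le (g : R -> R) a b : a <= b ->
  (forall x, a <= x <= b -> \forall t \near 0^', (g (x + t) - g x) / t < 0) ->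
  g b <= g a.
Proof.
move=> ab slope.
have loc x : a <= x <= b -> exists2 d, 0 < d &
    forall t, 0 < t < d -> g (x + t) < g x /\ g x < g (x - t).
  move=> /slope /nbhs_ballP[d /= d0 dP]; exists d => // t /andP[t0 td].
  have := dP t; have := dP (- t).
  rewrite /ball/= !sub0r !normrN gtr0_norm// oppr_eq0 gt_eqF// => /(_ td isT).
  rewrite invrN mulrN oppr_lt0 pmulr_lgt0 ?invr_gt0// subr_gt0 => h1 /(_ td isT).
  by rewrite pmulr_llt0 ?invr_gt0// subr_lt0.
(* The supremum [s] lies in [S] because [g] is larger just to the left of [s], and [s < b] is
   impossible because [g] is smaller just to the right. *)
pose S := [set x | a <= x <= b /\ g x <= g a].
have Sa : S a by rewrite /S /= !lexx.
have hsS : has_sup S by split; [exists a|exists b => x [/andP[]]].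
pose s := sup S.
have as_ : a <= s by exact: sup_upper_bound.
have sb : s <= b by apply: ge_sup; [exists a|move=> x [/andP[]]].
have [|d d0 dP] := loc s; first by rewrite as_.
have gs : g s <= g a.
  have [x [[xab xa] sx]] := sup_adherent d0 hsS.
  have xs : x <= s by apply: sup_upper_bound.
  have [->//|xns] := eqVneq s x.
  apply: le_trans xa; apply: ltW.
  have -> : x = s - (s - x) by rewrite opprB addrC subrK.
  apply: (dP _ _).2; rewrite subr_gt0 lt_neqAle eq_sym xns xs/=; rewrite -/s in sx; lra.
have [->//|sb'] := eqVneq b s.
have {}sb : s < b by rewrite lt_neqAle eq_sym sb' sb.
pose t := Num.min (d / 2) (b - s).
have t0 : 0 < t by rewrite lt_min divr_gt0//= subr_gt0.
have td : t <= d / 2 by rewrite ge_min lexx.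
have tb : t <= b - s by rewrite ge_min lexx orbT.
have [|lt1 _] := dP t; first by rewrite t0; lra.
have : s + t <= s.
  apply: sup_upper_bound => //; split; first by apply/andP; split; lra.
  by rewrite (le_trans (ltW lt1)).
lra.
Qed.

(** Subtracting [K' * x] with [K' > K] makes all slopes negative; then [K'] tends to [K], with slack
    [e / (b - a)]. *)
Lemma slope_lt_increment (g : R -> R) a b K : a <= b ->
  (forall x, a <= x <= b -> forall K', K < K' ->
     \forall t \near 0^', (g (x + t) - g x) / t < K') ->
  g b - g a <= K * (b - a).
Proof.
move=> ab slope.
have [->|a'b] := eqVneq a b; first by rewrite !subrr mulr0.
have {}ab : a < b by rewrite lt_neqAle a'b.
apply/ler_addgt0Pr => e e0.
pose K' := K + e / (b - a).
have KK' : K < K' by rewrite ltrDl divr_gt0// subr_gt0.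
have := @local_decr_le (fun x => g x - K' * x) a b (ltW ab).
have : K' * (b - a) = K * (b - a) + e.
  by rewrite mulrDl divfK// gt_eqF// subr_gt0.
suff h : forall x, a <= x <= b ->
    \forall t \near 0^', (g (x + t) - K' * (x + t) - (g x - K' * x)) / t < 0.
  by move=> E /(_ h); lra.
move=> x /slope /(_ _ KK') nt; near=> t.
have t0 : t != 0 by near: t; exact: nbhs_dnbhs_neq.
have -> : (g (x + t) - K' * (x + t) - (g x - K' * x)) / t =
  (g (x + t) - g x) / t - K' by field.
by rewrite subr_lt0; near: t.
Unshelve. all: by end_near.
Qed.

(** Only an upper bound on the slope enters, so [fx] may be -oo: this is what makes fast decreasing
    pieces admissible. *)
Lemma fx_le_increment (f : 'rV[R]_2 -> R) y a b K : a <= b ->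
  (forall x, a <= x <= b ->
     has_fx f (vec2 x y) /\ (fx f (vec2 x y) <= K%:E)%E) ->
  f (vec2 b y) - f (vec2 a y) <= K * (b - a).
Proof.
move=> ab fK; apply: (@slope_lt_increment (fun x => f (vec2 x y))) => // x xab K' KK'.
have [fc fxK] := fK x xab.
have : nbhs (fx f (vec2 x y)) [set u | (u < K'%:E)%E].
  apply: open_nbhs_nbhs; split; first exact: open_ereal_lt_ereal.
  by rewrite /= (le_lt_trans fxK)// lte_fin.
move=> /fc H; near=> t.
suff : (x_quotient f (vec2 x y) t < K'%:E)%E.
  by rewrite /x_quotient !vec2E lte_fin.
by near: t; exact: H.
Unshelve. all: by end_near.
Qed.

Lemma fx_ge_increment (f : 'rV[R]_2 -> R) y a b K : a <= b ->
  (forall x, a <= x <= b ->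
     has_fx f (vec2 x y) /\ (K%:E <= fx f (vec2 x y))%E) ->
  K * (b - a) <= f (vec2 b y) - f (vec2 a y).
Proof.
move=> ab fK.
have := @slope_lt_increment (fun x => - f (vec2 x y)) a b (- K) ab.
move=> h; suff : - f (vec2 b y) - - f (vec2 a y) <= - K * (b - a) by lra.
apply: h => x xab K' KK'.
have [fc fxK] := fK x xab.
have : nbhs (fx f (vec2 x y)) [set u | ((- K')%:E < u)%E].
  apply: open_nbhs_nbhs; split; first exact: open_ereal_gt_ereal.
  by rewrite /= (lt_le_trans _ fxK)// lte_fin ltrNl.
move=> /fc H; near=> t.
suff : ((- K')%:E < x_quotient f (vec2 x y) t)%E.
  by rewrite /x_quotient !vec2E lte_fin -opprD mulNr ltrNl.
by near: t; exact: H.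
Unshelve. all: by end_near.
Qed.

(** A one-sided Lipschitz bound in [x], uniform in [y]. Applied to [- F] it bounds the decrease of
    [F]. *)
Definition incr_le (F : R -> R -> R) (eps : R) (a b : R -> R) :=
  exists2 K, 0 < K & forall y x x', 0 < y <= eps ->
    a y <= x -> x <= x' -> x' <= b y -> F x' y - F x y <= K * (x' - x).

Definition slice (f : 'rV[R]_2 -> R) x y := f (vec2 x y).

(** * One-sided Lipschitz bounds for the kinds of pieces *)

Lemma punctured_region_vec2 eps (a b : R -> R) x y :
  0 < y <= eps -> a y <= x <= b y -> punctured_region eps a b (vec2 x y).
Proof.
move=> /andP[y0 ye] xab; split; first by split; rewrite !vec2E ?(ltW y0).
by move=> /(congr1 ycoord); rewrite ycoord_vec2 /ycoord mxE => /eqP; rewrite gt_eqF.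
Qed.

Lemma fx_le_incr (f : 'rV[R]_2 -> R) eps a b K : 0 < K ->
  (forall q, punctured_region eps a b q ->
     has_fx f q /\ (fx f q <= K%:E)%E) ->
  incr_le (slice f) eps a b.
Proof.
move=> K0 fK; exists K => // y x x' ye ax xx' xb.
apply: fx_le_increment => // z /andP[xz zx']; apply: fK.
by apply: punctured_region_vec2 => //; rewrite (le_trans ax)// (le_trans zx').
Qed.

Lemma fx_ge_incr (f : 'rV[R]_2 -> R) eps a b K : 0 < K ->
  (forall q, punctured_region eps a b q ->
     has_fx f q /\ ((- K)%:E <= fx f q)%E) ->
  incr_le (fun x y => - slice f x y) eps a b.
Proof.
move=> K0 fK; exists K => // y x x' ye ax xx' xb.
rewrite /slice.
suff : - K * (x' - x) <= f (vec2 x' y) - f (vec2 x y) by lra.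
apply: fx_ge_increment => // z /andP[xz zx']; apply: fK.
by apply: punctured_region_vec2 => //; rewrite (le_trans ax)// (le_trans zx').
Qed.

Lemma FL_incr (f : 'rV[R]_2 -> R) eps a b : FL f eps a b ->
  incr_le (slice f) eps a b /\ incr_le (fun x y => - slice f x y) eps a b.
Proof.
move=> [K K0 fK]; split.
  apply: (@fx_le_incr _ _ _ _ K) => // q /fK[fq h]; split => //.
  by rewrite (le_trans _ h)// lee_abs.
apply: (@fx_ge_incr _ _ _ _ K) => // q /fK[fq h]; split => //; move: h.
by case: fx => [r| |] //=; rewrite !lee_fin ler_norml => /andP[].
Qed.

(** Induction on the number of pieces: an interval is split at the dividing arc, and the sum of the
    two constants serves for the union. *)
Lemma incr_le_union F m eps f (Q : (R -> R) -> (R -> R) -> Prop) a b :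
  (forall a' b', Q a' b' -> incr_le F eps a' b') ->
  union_of_pieces f m eps Q a b -> incr_le F eps a b.
Proof.
move=> QF [n [s [n0 sa sb pieces]]].
suff : forall i, (i <= n)%N -> (forall y, 0 < y <= eps -> s 0%N y <= s i y) /\
     incr_le F eps (s 0%N) (s i).
  by rewrite -sa -sb => /(_ n (leqnn n))[].
elim=> [_|i IH ltin].
  split => //; exists 1 => // y x x' ye ax xx' xb.
  have -> : x = x' by apply/eqP; rewrite eq_le xx' (le_trans xb).
  by rewrite !subrr mulr0.
have [s0i [K K0 FK]] := IH (ltnW ltin).
have [[_ _ si _] /QF[K' K'0 FK']] := pieces i ltin.
have {}si y : 0 < y <= eps -> s i y <= s i.+1 y by move=> /si[_ /ltW].
split; first by move=> y ye; rewrite (le_trans (s0i _ ye))// si.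
exists (K + K'); first exact: addr_gt0.
move=> y x x' ye ax xx' xb.
have w : 0 <= K * (x' - x) /\ 0 <= K' * (x' - x).
  by split; rewrite mulr_ge0 ?subr_ge0// ltW.
have [x'i|ix'] := leP x' (s i y).
  by have := FK y x x' ye ax xx' x'i; lra.
have [ix|xi] := leP (s i y) x.
  by have := FK' y x x' ye ix xx' xb; lra.
have h1 := FK y x (s i y) ye ax (ltW xi) (lexx _).
have h2 := FK' y (s i y) x' ye (lexx _) (ltW ix') xb.
have : 0 <= K * (x' - s i y) by rewrite mulr_ge0 ?subr_ge0// ltW.
have : 0 <= K' * (s i y - x) by rewrite mulr_ge0 ?subr_ge0// ltW.
lra.
Qed.

Lemma NFI_incr (f : 'rV[R]_2 -> R) m eps a b : NFI f m eps a b ->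
  incr_le (slice f) eps a b.
Proof.
apply: incr_le_union => a' b' [/FL_incr[]//|[[K K0 fK] _]].
apply: (fx_le_incr K0) => q /fK[? h]; split => //.
by rewrite (le_trans h)// lee_fin; lra.
Qed.

Lemma NFD_incr (f : 'rV[R]_2 -> R) m eps a b : NFD f m eps a b ->
  incr_le (fun x y => - slice f x y) eps a b.
Proof.
apply: incr_le_union => a' b' [/FL_incr[]//|[[K K0 fK] _]].
apply: (fx_ge_incr K0) => q /fK[? h]; split => //.
by rewrite (le_trans _ h)// lee_fin; lra.
Qed.

(** * Points at equal height on opposite walls *)

Lemma IVT_between (g : R -> R) a b v : a <= b ->
  (forall x, a <= x <= b -> {for x, continuous g}) ->
  (g a <= v <= g b) || (g b <= v <= g a) ->
  exists2 c, a <= c <= b & g c = v.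
Proof.
move=> ab gc gv; have [||c] := @IVT R g a b v ab.
- apply/subspace_continuousP => x /=; rewrite in_itv/= => xab.
  by apply: cvg_within_filter; exact: gc.
- by rewrite ge_min le_max; case/orP: gv => /andP[-> ->]; rewrite ?orbT.
by rewrite in_itv/= => cab gcv; exists c.
Qed.

(* Instead of a regularity theorem for [g]: adding the penalty
   [- M * |y - Y|] forces a near-maximum into the interior of the interval,
   and near-maximality is a one-sided Lipschitz estimate at [y]. *)
Lemma near_max_lipschitz (g : R -> R) (C Y delta : R) :
  0 <= C -> 0 < Y -> 0 < delta -> delta <= Y ->
  (forall y, Y / 2 <= y <= 2 * Y -> `|g y| <= C * y) ->
  exists2 y, 3 * Y / 4 <= y <= 5 * Y / 4 &
    forall y', Y / 2 <= y' <= 2 * Y ->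
      g y' <= g y + 4 * (3 * C + 1) * `|y' - y| + delta.
Proof.
(* Comparing a near-maximum with [Y] bounds [M * |y - Y|] by [2 * C * Y + C * Y + delta], at most
   [(3 * C + 1) * Y]; the factor 4 turns this into [|y - Y| <= Y / 4]. *)
move=> C0 Y0 d0 dY gb; pose M := 4 * (3 * C + 1).
have M0 : 0 < M by rewrite /M; lra.
have YY : Y / 2 <= Y <= 2 * Y by lra.
have gub y : Y / 2 <= y <= 2 * Y -> g y <= 2 * (C * Y).
  move=> yY; apply: (le_trans (ler_norm _)); apply: (le_trans (gb y yY)).
  by rewrite mulrCA ler_wpM2l//; case/andP: yY.
pose S := [set g y - M * `|y - Y| | y in [set y | Y / 2 <= y <= 2 * Y]].
have hsS : has_sup S.
  split; first by exists (g Y - M * `|Y - Y|); exists Y.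
  exists (2 * (C * Y)) => _ [y /= yY <-].
  by rewrite (le_trans _ (gub y yY))// gerBl mulr_ge0// ltW.
have [_ [y /= yY <-] ys] := sup_adherent d0 hsS.
have near_max y' : Y / 2 <= y' <= 2 * Y ->
    g y' - M * `|y' - Y| <= g y - M * `|y - Y| + delta.
  move=> y'Y; rewrite -lerBlDr; apply: (le_trans _ (ltW ys)).
  by rewrite lerD2r; apply: sup_upper_bound => //; exists y'.
exists y.
  suff : `|y - Y| <= Y / 4 by rewrite ler_distl => /andP[? ?]; lra.
  have := near_max Y YY; rewrite subrr normr0 mulr0 subr0 => h.
  have g1 : - (C * Y) <= g Y by move: (gb Y YY); rewrite ler_norml => /andP[].
  have g2 := gub y yY.
  rewrite -(ler_pM2l M0) (_ : M * (Y / 4) = 3 * (C * Y) + Y); last first.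
    by rewrite /M; field.
  by clear -h g1 g2 dY; lra.
move=> y' /near_max.
have : M * `|y' - Y| <= M * (`|y' - y| + `|y - Y|).
  by rewrite ler_pM2l// ler_distD.
by rewrite -/M; clear; lra.
Qed.

(** With [y] a near-maximum of the bottom [F (r1 y) y], the bottom at a height [y'] close to [y]
    stays well below the level [om y / 2] above the bottom at [y], at which the two wall points are
    taken. *)
Lemma valley (F : R -> R -> R) (r0 r1 r3 om : R -> R) (e0 C : R) :
  0 < e0 -> 0 <= C ->
  (forall y, 0 < y < e0 -> r0 y <= r1 y <= r3 y) ->
  (forall y x, 0 < y < e0 -> r0 y <= x <= r3 y -> {for x, continuous (F ^~ y)}) ->
  (forall y, 0 < y < e0 -> `|F (r1 y) y| <= C * y) ->
  (forall y, 0 < y < e0 -> 0 < om y) ->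
  (forall y y', 0 < y -> y <= y' -> y' < e0 -> om y <= om y') ->
  (forall y, 0 < y < e0 ->
     exists2 x, r0 y <= x <= r1 y & F (r1 y) y + om y <= F x y) ->
  (forall y, 0 < y < e0 ->
     exists2 x, r1 y <= x <= r3 y & F (r1 y) y + om y <= F x y) ->
  (forall tau, 0 < tau -> exists2 e, 0 < e & forall y, 0 < y < e ->
     r3 y - r0 y <= tau * om y /\ r3 y - r0 y <= tau * y) ->
  forall L e, 0 < L -> 0 < e -> exists y xl xr,
    [/\ 0 < y < e, r0 y <= xl < r1 y, r1 y < xr <= r3 y, F xl y = F xr y &
      forall y', `|y' - y| <= L * (xr - xl) ->
        0 < y' < e /\ L * (xr - xl) < `|F xl y - F (r1 y') y'|].
Proof.
move=> e00 C0 rord Fc Fb om0 om_mono left right small L e L0 e1_0.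
pose M := 4 * (3 * C + 1).
have M0 : 0 < M by rewrite /M; lra.
have M1 : 0 < M + 1 by rewrite addr_gt0.
have LM0 : 0 < L * (M + 1) by rewrite mulr_gt0.
(* For [D = xr - xl] this gives [L * (M + 1) * D <= om y / 8], which controls the rise of the
   bottom, and [L * D <= y / 8], which keeps [y'] in the window. *)
pose tau := (8 * (L * (M + 1)))^-1.
have tau0 : 0 < tau by rewrite invr_gt0 mulr_gt0.
have tau1 : tau * (L * (M + 1)) = 8^-1 by rewrite /tau invfM mulfVK// gt_eqF.
have tau2 : tau * L <= 8^-1.
  by rewrite -tau1 mulrA ler_peMr ?mulr_ge0 ?lerDr// ltW.
have [e2 e20 smallP] := small _ tau0.
pose E := Num.min (Num.min e e0) e2.
have E0 : 0 < E by rewrite !lt_min e1_0 e00.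
have [Ee Ee0 Ee2] : [/\ E <= e, E <= e0 & E <= e2].
  by rewrite !ge_min !lexx !orbT.
move: E E0 Ee Ee0 Ee2 => E E0 Ee Ee0 Ee2.
(* The window from [Y / 2] to [2 * Y] then lies inside the interval from 0 to [E]. *)
pose Y := E / 4.
have Y0 : 0 < Y by rewrite divr_gt0.
have YE : 4 * Y = E by rewrite /Y; field.
move: Y Y0 YE => Y Y0 YE.
have omY : 0 < om (Y / 2) by apply: om0; clear -Y0 YE Ee0; lra.
(* The error is fixed before [y] is known; monotonicity of [om] makes it at most [om y / 8], since
   [y] exceeds [Y / 2]. *)
pose delta := Num.min Y (om (Y / 2) / 8).
have d0 : 0 < delta by rewrite lt_min Y0 divr_gt0.
have dY : delta <= Y by rewrite ge_min lexx.
have dom : delta <= om (Y / 2) / 8 by rewrite ge_min lexx orbT.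
have gb y : Y / 2 <= y <= 2 * Y -> `|F (r1 y) y| <= C * y.
  by move=> /andP[h1 h2]; apply: Fb; clear -h1 h2 Y0 YE Ee0; lra.
have [y /andP[yl yr]] := near_max_lipschitz C0 Y0 d0 dY gb.
rewrite -/M => near_max.
move: delta d0 dY dom near_max => delta d0 dY dom near_max.
have [y0 [ye ye0 ye2]] : 0 < y /\ [/\ y < e, y < e0 & y < e2].
  by clear -yl yr Y0 YE Ee Ee0 Ee2; split; [lra|split; lra].
have {}ye0 : 0 < y < e0 by rewrite y0.
have omy := om0 y ye0.
have omYy : om (Y / 2) <= om y.
  by apply: om_mono; [rewrite divr_gt0|clear -yl Y0; lra|case/andP: ye0].
have [r01 r13] := andP (rord y ye0).
have [xl0 /andP[r0l lr1] Fl] := left y ye0.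
have [xr0 /andP[r1r rr3] Fr] := right y ye0.
have Fcy x : r0 y <= x <= r3 y -> {for x, continuous (F ^~ y)} by apply: Fc.
have [s1 s2] : r3 y - r0 y <= tau * om y /\ r3 y - r0 y <= tau * y.
  by apply: smallP; rewrite y0.
set g := F (r1 y) y in near_max Fl Fr *.
clear rord Fc Fb om_mono left right small smallP gb om0.
have [||xl /andP[xl1 xl2] Fxl] :=
  @IVT_between (F ^~ y) xl0 (r1 y) (g + om y / 2) lr1.
- by move=> x /andP[h1 h2]; apply: Fcy; clear -r0l r13 h1 h2; lra.
- by apply/orP; right; rewrite -/g; clear -Fl omy; lra.
have [||xr /andP[xr1 xr2] Fxr] :=
  @IVT_between (F ^~ y) (r1 y) xr0 (g + om y / 2) r1r.
- by move=> x /andP[h1 h2]; apply: Fcy; clear -r01 rr3 h1 h2; lra.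
- by apply/orP; left; rewrite -/g; clear -Fr omy; lra.
have g_lt : g != g + om y / 2.
  by rewrite lt_eqF// ltrDl divr_gt0.
exists y, xl, xr.
have xlr : xl < r1 y.
  rewrite lt_neqAle xl2 andbT; apply: contra g_lt => /eqP xlE.
  by rewrite -Fxl xlE.
have xrr : r1 y < xr.
  rewrite lt_neqAle xr1 andbT; apply: contra g_lt => /eqP xrE.
  by rewrite -Fxr -xrE.
split => //.
- by rewrite y0.
- by rewrite xlr andbT (le_trans r0l).
- by rewrite xrr (le_trans xr2).
- by rewrite Fxl Fxr.
move=> y' yy'.
have D0 : 0 <= xr - xl by clear -xlr xrr; lra.
have Dr : xr - xl <= r3 y - r0 y by clear -xl1 r0l xr2 rr3; lra.
have LD1 : L * (M + 1) * (xr - xl) <= om y / 8.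
  apply: (@le_trans _ _ (L * (M + 1) * (tau * om y))).
    by rewrite ler_pM2l// (le_trans Dr).
  by rewrite mulrA (mulrC _ tau) tau1 mulrC.
have LD2 : L * (xr - xl) <= y / 8.
  apply: (@le_trans _ _ (L * (tau * y))); first by rewrite ler_pM2l// (le_trans Dr).
  by rewrite mulrA (mulrC _ tau) (mulrC y) ler_pM2r.
have /andP[y'l y'r] : y - y / 8 <= y' <= y + y / 8.
  by rewrite -ler_distl (le_trans yy').
split; first by clear -y'l y'r y0 yr YE Ee; lra.
rewrite Fxl; apply: lt_le_trans (ler_norm _).
(* From the level [g + om y / 2], the descent to the bottom at [y'] is at least
   [om y / 2 - M * L * D - om y / 8], with [D = xr - xl]; this exceeds [L * D]. *)
have {}near_max : F (r1 y') y' <= g + M * `|y' - y| + delta.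
  by apply: near_max; clear -y'l y'r yl yr Y0; lra.
have : M * `|y' - y| <= M * (L * (xr - xl)) by rewrite ler_pM2l.
by clear -near_max LD1 dom omYy omy; lra.
Qed.

(** * Comparing the orders of width and height *)

Lemma near_0rightP (P : R -> Prop) :
  (\forall y \near 0^'+, P y) <-> exists2 e, 0 < e & forall y, 0 < y < e -> P y.
Proof.
split=> [/nbhs_ballP[e /= e0 eP]|[e e0 eP]].
  exists e => // y /andP[y0 ye]; apply: eP => //.
  by rewrite /ball/= sub0r normrN gtr0_norm.
near=> y; apply: eP; apply/andP; split; first by near: y; exact: nbhs_right_gt.
by near: y; exact: nbhs_right_lt.
Unshelve. all: by end_near.
Qed.

Lemma order_inv_lower eps (g : R -> R) h : 0 < eps -> order_inv eps g h ->
  (forall y, 0 <= g y) ->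
  exists2 c, 0 < c & \forall y \near 0^'+, c * y `^ ratr h^-1 <= g y.
Proof.
move=> eps0 [h0 [u [l l0 ul] gu]] g0.
exists (`|l| / 2); first by rewrite divr_gt0// normr_gt0.
have ul' : `|u y| @[y --> 0^'+] --> `|l| by exact: cvg_norm.
have l2 : `|l| / 2 < `|l| by rewrite ltr_pdivrMr// ltr_pMr ?normr_gt0// ltr1n.
near=> y.
have ye : 0 < y <= eps.
  by apply/andP; split; near: y; [exact: nbhs_right_gt|exact: nbhs_right_le].
rewrite -(ger0_norm (g0 y)) (gu _ ye) normrM (ger0_norm (powR_ge0 _ _)) mulrC.
rewrite ler_wpM2l ?powR_ge0// ltW//; near: y; exact: (cvgr_gt _ ul' _ l2).
Unshelve. all: by end_near.
Qed.

Lemma order_inv_upper eps (g : R -> R) h : 0 < eps -> order_inv eps g h ->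
  exists2 c, 0 < c & \forall y \near 0^'+, g y <= c * y `^ ratr h^-1.
Proof.
move=> eps0 [h0 [u [l l0 ul] gu]].
exists (`|l| + 1); first by rewrite ltr_wpDl.
have ul' : `|u y| @[y --> 0^'+] --> `|l| by exact: cvg_norm.
have l2 : `|l| < `|l| + 1 by rewrite ltrDl.
near=> y.
have ye : 0 < y <= eps.
  by apply/andP; split; near: y; [exact: nbhs_right_gt|exact: nbhs_right_le].
rewrite (gu _ ye) mulrC ler_wpM2r ?powR_ge0// (le_trans (ler_norm _))// ltW//.
near: y; exact: (cvgr_lt _ ul' _ l2).
Unshelve. all: by end_near.
Qed.

Lemma powR_small (a tau : R) : 0 < a -> 0 < tau ->
  \forall y \near 0^'+, y `^ a <= tau.
Proof.
move=> a0 tau0; have pa : x `^ a @[x --> 0^'+] --> (0 : R) by exact: powR_cvg0.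
exact: cvgr_le _ pa _ tau0.
Qed.

(** A form of the height that passes from [F] to [- F] by exchanging the two points. *)
Definition oscillates (F : R -> R -> R) (eps : R) (a b : R -> R) (h : rat) :=
  exists2 g, (forall y, 0 <= g y) /\ order_inv eps g h &
    forall y, 0 < y <= eps -> exists x x',
      [/\ a y <= x <= b y, a y <= x' <= b y & F x y - F x' y = g y].

(** On either outer piece, the lower of the two oscillating points is at least [F (r1 y) y] minus a
    multiple of the width, by the one-sided bounds on the way to [r1]. As the width is negligible
    against the oscillation, the upper point is high above [F (r1 y) y]. *)
Lemma narrow_valley (F : R -> R -> R) (eps C e1 : R) (r0 r1 r2 r3 : R -> R)
    (w h1 h3 : rat) :
  0 < eps -> 0 <= C -> 0 < e1 ->
  (forall y, 0 < y <= eps -> [/\ r0 y <= r1 y, r1 y <= r2 y & r2 y <= r3 y]) ->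
  (forall y x, 0 < y < e1 -> r0 y <= x <= r3 y ->
     {for x, continuous (F ^~ y)} /\ `|F x y| <= C * y) ->
  incr_le F eps r0 r1 ->
  incr_le (fun x y => - F x y) eps r1 r2 ->
  incr_le (fun x y => - F x y) eps r2 r3 ->
  is_width eps r0 r3 w ->
  oscillates F eps r0 r1 h1 -> oscillates F eps r2 r3 h3 ->
  w < Num.min h1 h3 ->
  forall L e, 0 < L -> 0 < e -> exists y xl xr,
    [/\ 0 < y < e, r0 y <= xl < r1 y, r1 y < xr <= r3 y, F xl y = F xr y &
      forall y', `|y' - y| <= L * (xr - xl) ->
        0 < y' < e /\ L * (xr - xl) < `|F xl y - F (r1 y') y'|].
Proof.
move=> eps0 C0 e10 rord Fcb [K1 K10 F1] [K2 K20 F2] [K3 K30 F3] wd.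
move=> [g1 [g1_ge0 o1] P1] [g3 [g3_ge0 o3] P3] wh.
have [c1 c10 G1] := order_inv_lower eps0 o1 g1_ge0.
have [c3 c30 G3] := order_inv_lower eps0 o3 g3_ge0.
have [cD cD0 GD] := order_inv_upper eps0 wd.
have [h10 h30] : 0 < h1 /\ 0 < h3 by split; [case: o1|case: o3].
have w0 : 0 < w by case: wd.
pose h := Num.min h1 h3.
have h0 : 0 < h by rewrite lt_min h10.
pose a : R := ratr h^-1.
(* Halving makes both oscillations at least [2 * om y]: one [om y] is spent on the Lipschitz errors,
   the other is the depth. *)
pose c := Num.min c1 c3 / 2.
have c0 : 0 < c by rewrite divr_gt0// lt_min c10.
have [cc1 cc3] : 2 * c <= c1 /\ 2 * c <= c3.
  by rewrite /c mulrC divfK//; split; rewrite ge_min lexx ?orbT.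
pose om y := c * y `^ a.
have a0 : 0 < a by rewrite ltr0q invr_gt0.
(* This is where [w < min h1 h3] enters: the quotient of width and depth is bounded by a multiple of
   a positive power of [y]. *)
have ab : 0 < ratr w^-1 - a by rewrite subr_gt0 ltr_rat ltf_pV2 ?posrE.
have small_om tau : 0 < tau ->
    \forall y \near 0^'+, r3 y - r0 y <= tau * om y.
  move=> tau0.
  have t0 : 0 < tau * c / cD by rewrite divr_gt0// mulr_gt0.
  near=> y.
  have y0 : 0 < y by near: y; exact: nbhs_right_gt.
  have h1' : y `^ (ratr w^-1 - a) <= tau * c / cD by near: y; exact: powR_small.
  apply: le_trans (ler_norm _) _.
  have GDy : `|r3 y - r0 y| <= cD * y `^ ratr w^-1 by near: y.
  apply: (le_trans GDy).
  have -> : ratr w^-1 = (ratr w^-1 - a) + a :> R by rewrite subrK.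
  rewrite powRD; last by rewrite (gt_eqF y0) implybT.
  have E : cD * y `^ (ratr w^-1 - a) <= tau * c.
    by rewrite mulrC -ler_pdivlMr.
  by have := ler_wpM2r (powR_ge0 y a) E; rewrite /om !mulrA.
have K0 : 0 < K1 + K2 + K3 by rewrite !addr_gt0.
have ok : \forall y \near 0^'+,
    [/\ y < e1, y <= eps,
        2 * om y <= g1 y, 2 * om y <= g3 y
      & (K1 + K2 + K3) * (r3 y - r0 y) <= om y].
  have Kinv : 0 < (K1 + K2 + K3)^-1 by rewrite invr_gt0.
  near=> y.
  have y0 : 0 < y by near: y; exact: nbhs_right_gt.
  have y1 : y <= 1 by near: y; exact: nbhs_right_le.
  have pow k : 0 < k -> h <= k -> y `^ a <= y `^ ratr k^-1.
    move=> k0 hk; rewrite ger_powR ?y0// ler_rat lef_pV2 ?posrE//.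
  have om2 k b : 0 < k -> h <= k -> 2 * c <= b -> 2 * om y <= b * y `^ ratr k^-1.
    move=> k0 hk cb; rewrite /om mulrA; apply: ler_pM => //.
    - by rewrite mulr_ge0// ltW.
    - exact: powR_ge0.
    - exact: pow.
  split.
  - by near: y; exact: nbhs_right_lt.
  - by near: y; exact: nbhs_right_le.
  - apply: (le_trans (om2 h1 c1 h10 _ cc1)); first by rewrite ge_min lexx.
    by near: y.
  - apply: (le_trans (om2 h3 c3 h30 _ cc3)); first by rewrite ge_min lexx orbT.
    by near: y.
  - by rewrite mulrC -ler_pdivlMr// mulrC; near: y; exact: small_om.
have [e0 e00 {}ok] := (near_0rightP _).1 ok.
have om_gt0 y : 0 < y -> 0 < om y by move=> y0; rewrite mulr_gt0// powR_gt0.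
have left y : 0 < y < e0 ->
    exists2 x, r0 y <= x <= r1 y & F (r1 y) y + om y <= F x y.
  move=> ye; have [_ yeps og1 _ KD] := ok y ye.
  have ye' : 0 < y <= eps by case/andP: ye => ->.
  have [r01 r12 r23] := rord y ye'.
  have [x [x' [/andP[x1 x2] /andP[x1' x2'] Fx]]] := P1 y ye'.
  exists x; first by rewrite x1.
  have := F1 y x' (r1 y) ye' x1' x2' (lexx _).
  have : K1 * (r1 y - x') <= K1 * (r3 y - r0 y) by rewrite ler_pM2l//; lra.
  have : 0 <= K2 * (r3 y - r0 y) by apply: mulr_ge0; [exact: ltW|lra].
  have : 0 <= K3 * (r3 y - r0 y) by apply: mulr_ge0; [exact: ltW|lra].
  lra.
have right y : 0 < y < e0 ->
    exists2 x, r1 y <= x <= r3 y & F (r1 y) y + om y <= F x y.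
  move=> ye; have [_ yeps _ og3 KD] := ok y ye.
  have ye' : 0 < y <= eps by case/andP: ye => ->.
  have [r01 r12 r23] := rord y ye'.
  have [x [x' [/andP[x1 x2] /andP[x1' x2'] Fx]]] := P3 y ye'.
  exists x; first by rewrite x2 andbT; lra.
  have := F2 y (r1 y) (r2 y) ye' (lexx _) r12 (lexx _).
  have := F3 y (r2 y) x' ye' (lexx _) x1' x2'.
  have : K2 * (r2 y - r1 y) <= K2 * (r3 y - r0 y) by rewrite ler_pM2l//; lra.
  have : K3 * (x' - r2 y) <= K3 * (r3 y - r0 y) by rewrite ler_pM2l//; lra.
  have : 0 <= K1 * (r3 y - r0 y) by apply: mulr_ge0; [exact: ltW|lra].
  lra.
apply: (@valley F r0 r1 r3 om e0 C) => //.
- move=> y ye; have [_ yeps _ _ _] := ok y ye.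
  have [] := rord y; first by case/andP: ye => ->.
  by move=> -> /=; exact: le_trans.
- move=> y x ye xr; have [ye1 _ _ _ _] := ok y ye.
  by case: (Fcb y x _ xr) => //; case/andP: ye => ->.
- move=> y ye; have [ye1 yeps _ _ _] := ok y ye.
  have y0 : 0 < y by case/andP: ye.
  have [] := rord y; first by rewrite y0.
  move=> r01 r12 r23; have [] // := Fcb y (r1 y); rewrite ?y0//.
  by rewrite r01 (le_trans r12).
- by move=> y /andP[y0 _]; exact: om_gt0.
- move=> y y' y0 yy' _; rewrite ler_wpM2l ?(ltW c0)//.
  by rewrite ge0_ler_powR ?(ltW a0)// nnegrE ltW// (lt_le_trans y0).
move=> tau tau0; apply/near_0rightP.
(* The depth is a difference of values bounded by [C * y], so [om y <= (2 * C + 1) * y], and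
   smallness against [om y] gives smallness against [y]. *)
pose tau' := Num.min tau (tau / (2 * C + 1)).
have C1 : 0 < 2 * C + 1 by lra.
have tau'0 : 0 < tau' by rewrite lt_min tau0 divr_gt0.
have t1 : tau' <= tau by rewrite ge_min lexx.
have t2 : tau' * (2 * C + 1) <= tau.
  by rewrite -ler_pdivlMr// ge_min lexx orbT.
near=> y.
have y0 : 0 < y by near: y; exact: nbhs_right_gt.
have ye : 0 < y < e0 by rewrite y0/=; near: y; exact: nbhs_right_lt.
have D : r3 y - r0 y <= tau' * om y by near: y; exact: small_om.
split.
  by rewrite (le_trans D)// ler_wpM2r// ltW// om_gt0.
have [ye1 yeps _ _ _] := ok y ye.
have [r01 r12 r23] : [/\ r0 y <= r1 y, r1 y <= r2 y & r2 y <= r3 y].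
  by apply: rord; rewrite y0.
have [x /andP[x1 x2] Fx] := left y ye.
have [_ b1] : {for x, continuous (F ^~ y)} /\ `|F x y| <= C * y.
  by apply: Fcb; rewrite ?y0//; lra.
have [_ b2] : {for r1 y, continuous (F ^~ y)} /\ `|F (r1 y) y| <= C * y.
  by apply: Fcb; rewrite ?y0//; lra.
have omC : om y <= (2 * C + 1) * y.
  by move: b1 b2; rewrite !ler_norml => /andP[_ b1] /andP[b2 _]; lra.
apply: (le_trans D); apply: (@le_trans _ _ (tau' * ((2 * C + 1) * y))).
  by rewrite ler_pM2l.
by rewrite mulrA ler_pM2r.
Unshelve. all: by end_near.
Qed.

End Valley.

(** * Paths *)

Section Paths.
Variable R : realType.
Implicit Types (x y z : R).

(** Weierstrass test: at a radius [rho] between [|v|] and [|u|] the series converges absolutely, and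
    its tails bound those at all [|x| <= rho]. *)
Lemma pseries_continuous (a : nat -> R) (u v : R) :
  cvgn (pseries a u) -> `|v| < `|u| ->
  {for v, continuous (fun x => limn (pseries a x))}.
Proof.
move=> au vu; pose rho := (`|v| + `|u|) / 2.
have v_rho : `|v| < rho by rewrite /rho; lra.
have rho_u : rho < `|u| by rewrite /rho; lra.
have rho0 : 0 <= rho by rewrite (le_trans (normr_ge0 v))// ltW.
have rho_u' : `|rho| < `|u| by rewrite ger0_norm.
have Tc := is_cvg_pseries_inside_norm au rho_u'.
set Tn := pseries _ _ in Tc; pose T := limn Tn.
have S_cvg x : `|x| <= rho -> cvgn (pseries a x).
  by move=> xr; apply: is_cvg_pseries_inside au _; rewrite (le_lt_trans xr).
have tail n m x : `|x| <= rho -> (n <= m)%N ->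
    `|pseries a x m - pseries a x n| <= Tn m - Tn n.
  move=> xr nm; rewrite /Tn !sub_series_geq//.
  rewrite (le_trans (ler_norm_sum _ _ _))//; apply: ler_sum => i _ /=.
  by rewrite normrM normrX ler_wpM2l// lerXn2r// nnegrE.
have tail_lim n x : `|x| <= rho -> `|limn (pseries a x) - pseries a x n| <= T - Tn n.
  move=> xr.
  have h1 : `|pseries a x m - pseries a x n| @[m --> \oo] -->
      `|limn (pseries a x) - pseries a x n|.
    by apply: cvg_norm; apply: cvgB; [exact: S_cvg|exact: cvg_cst].
  have h2 : Tn m - Tn n @[m --> \oo] --> T - Tn n.
    by apply: cvgB; [exact: Tc|exact: cvg_cst].
  apply: ler_cvg_to h1 h2 _; exists n => // m /= nm; exact: tail.
apply/cvgrPdist_lt => e e0.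
have e30 : 0 < e / 3 by rewrite divr_gt0.
have /cvgrPdist_lt/(_ _ e30)[N _ /(_ N (leqnn N))] := Tc.
rewrite -/T => TN.
have Tlt : T - Tn N < e / 3 by rewrite (le_lt_trans (ler_norm _)).
have Nc : pseries a x N @[x --> v] --> pseries a v N.
  rewrite /pseries/series/=; apply: (@cvg_big _ _ _ _ _ add_continuous) => i _.
  by apply: cvgM; [exact: cvg_cst|exact: exprn_continuous].
move/cvgrPdist_lt : Nc => /(_ _ e30) Nc; near=> x.
have xr : `|x| <= rho.
  rewrite ltW//; near: x; apply: (cvgr_lt _ _ _ v_rho).
  by apply: cvg_norm; exact: cvg_id.
have h1 := tail_lim N v (ltW v_rho).
have h2 := tail_lim N x xr.
have h3 : `|pseries a v N - pseries a x N| < e / 3 by near: x.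
have -> : limn (pseries a v) - limn (pseries a x) =
  (limn (pseries a v) - pseries a v N) + (pseries a v N - pseries a x N)
  - (limn (pseries a x) - pseries a x N) by ring.
rewrite (le_lt_trans (ler_normB _ _))//.
have := ler_normD (limn (pseries a v) - pseries a v N) (pseries a v N - pseries a x N).
lra.
Unshelve. all: by end_near.
Qed.

(** The series in the [N]-th root of [y] converges at [eps], so [y < eps] is inside its disk;
    [0 < y] makes the root differentiable. *)
Lemma analytic_arc_continuous eps (r : R -> R) y :
  analytic_arc eps r -> 0 < y < eps -> {for y, continuous r}.
Proof.
move=> [N [a [N0 ar]]] /andP[y0 ye].
pose k : R := N%:R^-1.
have k0 : 0 < k by rewrite invr_gt0 ltr0n.
have eps0 : 0 < eps by lra.
have pc : {for y, continuous (fun x : R => x `^ k)}.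
    apply: differentiable_continuous.
    by apply/derivable1_diffP/derivable_powR; rewrite in_itv/= andbT.
have sc : {for y `^ k, continuous (fun x => limn (pseries a x))}.
  apply: (@pseries_continuous _ (eps `^ k)).
    by apply/cvg_ex; exists (r eps); apply: ar; rewrite lexx ltW.
  rewrite !ger0_norm ?powR_ge0// gt0_ltr_powR// nnegrE; lra.
have E : \forall x \near y, r x = limn (pseries a (x `^ k)).
  near=> x; apply/esym/cvg_lim => //; apply: ar.
  apply/andP; split; apply: ltW; near: x; last exact: lt_nbhsl.
  by apply: (cvgr_gt (f := id) y) => //; exact: cvg_id.
have h : limn (pseries a (x `^ k)) @[x --> y] --> r y.
  by rewrite (nbhs_singleton E); exact: continuous_comp pc sc.
by apply: cvg_trans h; apply: near_eq_cvg; apply: filterS E => x ->.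
Unshelve. all: by end_near.
Qed.

Lemma analytic_on_coord_continuous n (g : R -> 'rV[R]_n) a b i :
  analytic_on g a b -> a < b -> {within `[a, b], continuous (fun t => g t 0 i)}.
Proof.
move=> ga ab; apply/subspace_continuousP => t0 /=; rewrite in_itv/= => t0ab.
have [c [d [d0 cd]]] := ga t0 t0ab.
pose c' k := c k 0 i.
have ps t : a <= t <= b -> `|t - t0| < d -> pseries c' (t - t0) @ \oo --> g t 0 i.
  move=> tab td; have := cd t tab td => h.
  have := cvg_comp _ (fun v : 'rV[R]_n => v 0 i) h (@coord_continuous _ _ _ _ _ _).
  apply: cvg_trans; apply: near_eq_cvg; apply: nearW => m /=.
  rewrite /pseries/series/= summxE; apply: eq_bigr => k _.
  by rewrite mxE mulrC.
(* Convergence at a second point shows that the radius of convergence is positive; at the right end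
   it must be taken on the left. *)
have [t1 [t1ab t1d t10]] : exists t1, [/\ a <= t1 <= b, `|t1 - t0| < d & t1 != t0].
  have [t0b|bt0] := ltP t0 b.
    pose h := Num.min (d / 2) (b - t0).
    have h0 : 0 < h by rewrite lt_min divr_gt0// subr_gt0.
    have hd : h <= d / 2 by rewrite ge_min lexx.
    have hb : h <= b - t0 by rewrite ge_min lexx orbT.
    exists (t0 + h); split; first lra.
      by rewrite addrAC subrr add0r gtr0_norm//; lra.
    by rewrite -subr_eq0 addrAC subrr add0r gt_eqF.
  pose h := Num.min (d / 2) (t0 - a).
  have h0 : 0 < h by rewrite lt_min divr_gt0// subr_gt0; lra.
  have hd : h <= d / 2 by rewrite ge_min lexx.
  have hb : h <= t0 - a by rewrite ge_min lexx orbT.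
  exists (t0 - h); split; first lra.
    by rewrite addrAC subrr add0r normrN gtr0_norm//; lra.
  by rewrite -subr_eq0 addrAC subrr add0r oppr_eq0 gt_eqF.
have sc : {for t0 - t0, continuous (fun x => limn (pseries c' x))}.
  apply: (@pseries_continuous _ (t1 - t0)).
    by apply/cvg_ex; exists (g t1 0 i); exact: ps.
  by rewrite subrr normr0 normr_gt0 subr_eq0.
have tc : {for t0, continuous (fun t => t - t0)}.
  by apply: cvgB; [exact: cvg_id|exact: cvg_cst].
have E t : a <= t <= b -> `|t - t0| < d -> limn (pseries c' (t - t0)) = g t 0 i.
  by move=> tab td; apply/cvg_lim => //; exact: ps.
have h : limn (pseries c' (t - t0)) @[t --> t0] --> g t0 0 i.
  rewrite -(E t0 t0ab); last by rewrite subrr normr0.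
  exact: (@continuous_comp _ _ _ (fun t => t - t0) _ t0 tc sc).
apply: (@cvg_trans _ ((fun t => limn (pseries c' (t - t0)))
    @ within `[a, b]%classic (nbhs t0))); last exact: cvg_within_filter h.
apply: near_eq_cvg; rewrite near_withinE; near=> t => /=; rewrite in_itv/= => tab.
exact: E.
Unshelve. all: by end_near.
Qed.

Lemma enorm_ge0 n (v : 'rV[R]_n) : 0 <= enorm v.
Proof. exact: sqrtr_ge0. Qed.

Lemma coord_enorm n (v : 'rV[R]_n) i : `|v 0 i| <= enorm v.
Proof.
rewrite -sqrtr_sqr ler_sqrt; last by apply: sumr_ge0 => j _; exact: sqr_ge0.
by rewrite (bigD1 i)//= lerDl; apply: sumr_ge0 => j _; exact: sqr_ge0.
Qed.

Lemma norm_le_enorm n (v : 'rV[R]_n) : `|v| <= enorm v.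
Proof.
rewrite [leLHS]/Num.norm /= mx_normrE; apply/bigmax_leP; split=> /=.
  exact: enorm_ge0.
by move=> [i j] _ /=; rewrite ord1; exact: coord_enorm.
Qed.

Lemma enorm0 n : enorm (0 : 'rV[R]_n) = 0.
Proof. by rewrite /enorm big1 ?sqrtr0// => i _; rewrite mxE expr0n. Qed.

Lemma enormZ n (a : R) (v : 'rV[R]_n) : enorm (a *: v) = `|a| * enorm v.
Proof.
rewrite /enorm -sqrtr_sqr -sqrtrM ?sqr_ge0// mulr_sumr; congr Num.sqrt.
by apply: eq_bigr => i _; rewrite mxE exprMn.
Qed.

Lemma enorm_vec3_axis x : enorm (vec3 x 0 0) = `|x|.
Proof.
rewrite /enorm -sqrtr_sqr; congr Num.sqrt.
by rewrite !big_ord_recl big_ord0 !mxE /= expr0n !addr0.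
Qed.

Lemma piecewise_analytic_coord_continuous n (g : R -> 'rV[R]_n) a b i :
  piecewise_analytic g a b -> {within `[a, b], continuous (fun t => g t 0 i)}.
Proof.
move=> [s]; elim: s a => [|x s IH] a sab ga.
  rewrite (itv_partition_nil sab) set_itv1.
  exact: continuous_subspace1.
have ax : a < x by case: sab => /= /andP[].
have sxb := itv_partition_cons sab.
have xb := itv_partition_le sxb.
rewrite (_ : `[a, b]%classic = `[a, x]%classic `|` `[x, b]%classic).
  apply: withinU_continuous; [exact: itv_closed|exact: itv_closed| |].
    by apply: analytic_on_coord_continuous => //; exact: (ga 0%N).
  by apply: IH => // j js; exact: (ga j.+1).
apply/seteqP; split => t /=; rewrite !in_itv/=.
  move=> /andP[at_ tb]; have [tx|xt] := leP t x; [left|right].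
    by rewrite at_.
  by rewrite (ltW xt).
move=> [/andP[-> tx]|/andP[xt ->]]; first exact: le_trans tx xb.
by rewrite (le_trans (ltW ax)).
Qed.

(** The intermediate value theorem for [X t - r (Y t)], whose sign tells the side of the curve
    [x = r y]. *)
Lemma crosses_graph (X Y r : R -> R) a b : a <= b ->
  {within `[a, b], continuous X} -> {within `[a, b], continuous Y} ->
  (forall t, a <= t <= b -> {for Y t, continuous r}) ->
  X a <= r (Y a) -> r (Y b) <= X b ->
  exists2 t, a <= t <= b & X t = r (Y t).
Proof.
move=> ab Xc Yc rc Xa Xb.
have [||t] := @IVT R (fun t => X t - r (Y t)) a b 0 ab.
- apply/subspace_continuousP => t tab; apply: cvgB.
    by move/subspace_continuousP : Xc; apply.
  apply: (cvg_comp Y r); last by apply: rc; move: tab; rewrite /= in_itv.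
  by move/subspace_continuousP : Yc; apply.
- by rewrite ge_min le_max !subr_le0 !subr_ge0 Xa Xb orbT.
- by rewrite in_itv/= => tab /eqP; rewrite subr_eq0 => /eqP; exists t.
Qed.

(** The polygon with vertices at 0, [t] and 1 has [g t - g 0] as its first edge. Partitions are
    strictly increasing, so [t = 0] and [t = 1] are treated apart. *)
Lemma arc_length_ge n (g : R -> 'rV[R]_n) l : (arc_length g 0 1 <= l%:E)%E ->
  forall t, 0 <= t <= 1 -> enorm (g t - g 0) <= l.
Proof.
move=> gl t /andP[]; rewrite le_eqVlt => /predU1P[<- _|t0 t1].
  rewrite subrr enorm0 -lee_fin; apply: le_trans gl.
  apply: le_trans (ereal_sup_ubound _); last first.
    by exists [:: 1]; [exact: itv_partition1|reflexivity].
  by rewrite lee_fin; apply: sumr_ge0 => i _; exact: enorm_ge0.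
rewrite -lee_fin; apply: le_trans gl.
move: t1; rewrite le_eqVlt => /predU1P[->|t1].
  apply: ereal_sup_ubound; exists [:: 1]; first exact: itv_partition1.
  by rewrite /polygon_length big_nat1.
apply: le_trans (ereal_sup_ubound _); last first.
  by exists [:: t; 1]; [rewrite /itv_partition /= t0 t1|reflexivity].
rewrite lee_fin /polygon_length /= big_nat_recl//= lerDl.
by apply: sumr_ge0 => i _; exact: enorm_ge0.
Qed.

Lemma inner_dist_le_path n (X : set 'rV[R]_n) p q l L :
  (inner_dist X p q <= l%:E)%E -> l < L ->
  exists g, joins X p q g /\ forall t, 0 <= t <= 1 -> enorm (g t - p) <= L.
Proof.
move=> pql lL.
have : (inner_dist X p q < L%:E)%E by rewrite (le_lt_trans pql)// lte_fin.
move=> /ereal_inf_lt[_ [g gj <-]] gL; exists g; split => //.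
by have [_ <- _ _] := gj; apply: arc_length_ge; exact: ltW.
Qed.

End Paths.

(** * Points on the two walls *)

Section Walls.
Variable R : realType.
Implicit Types (x y z : R).

Lemma enorm_le_norm n (v : 'rV[R]_n) : enorm v <= Num.sqrt n%:R * `|v|.
Proof.
rewrite -[X in _ * X]ger0_norm// -sqrtr_sqr -sqrtrM// ler_wsqrtr//.
rewrite mulr_natl -[X in _ *+ X]card_ord -sumr_const; apply: ler_sum => i _.
by rewrite -(real_normK (num_real _)) lerXn2r ?nnegrE// coord_norm.
Qed.

Lemma near_wedge (P : set 'rV[R]_2) m : 0 < m -> nbhs (0 : 'rV[R]_2) P ->
  exists2 e, 0 < e & forall x y, 0 < y < e -> `|x| <= m * y -> P (vec2 x y).
Proof.
move=> m0 nP.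
have v0 : vec2 0 0 = 0 :> 'rV[R]_2.
  by apply/rowP => -[[|[|//]] i2]; rewrite !mxE.
have := @vec2_continuous R (0, 0); rewrite /continuous_at /= v0.
move=> /(_ _ nP)/nbhs_ballP[d /= d0 dP].
exists (Num.min d (d / m)); first by rewrite lt_min d0 divr_gt0.
move=> x y /andP[y0]; rewrite lt_min => /andP[yd ydm] xy.
apply: (dP (x, y)); split; rewrite /ball/= sub0r normrN.
  by rewrite (le_lt_trans xy)// mulrC -ltr_pdivlMr.
by rewrite gtr0_norm.
Qed.

Lemma near_wedge3 (N : set 'rV[R]_3) m C : 0 < m -> 0 <= C ->
  nbhs (0 : 'rV[R]_3) N ->
  exists2 e, 0 < e & forall x y z, 0 < y < e -> `|x| <= m * y ->
    `|z| <= C * y -> N (vec3 x y z).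
Proof.
move=> m0 C0 nN.
have v0 : vec3 0 0 0 = 0 :> 'rV[R]_3.
  by apply/rowP => -[[|[|[|//]]] i2]; rewrite !mxE.
have := @vec3_continuous R ((0, 0), 0); rewrite /continuous_at /= v0.
move=> /(_ _ nN)/nbhs_ballP[d /= d0 dP].
have C1 : 0 < m + C + 1 by lra.
exists (d / (m + C + 1)); first by rewrite divr_gt0.
move=> x y z /andP[y0]; rewrite ltr_pdivlMr// => yd xy zy.
have my : 0 < m * y by rewrite mulr_gt0.
have Cy : 0 <= C * y by rewrite mulr_ge0// ltW.
apply: (dP ((x, y), z)); split; [split|]; rewrite /ball/= sub0r normrN.
- lra.
- by rewrite gtr0_norm//; lra.
- lra.
Qed.

Lemma norm_vec2_le m : exists2 C, 0 <= C & forall x y, 0 <= y -> `|x| <= m * y ->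
  `|vec2 x y : 'rV[R]_2| <= C * y.
Proof.
exists (`|m| * `|vec2 1 0 : 'rV[R]_2| + `|vec2 0 1 : 'rV[R]_2|).
  by rewrite addr_ge0// mulr_ge0.
move=> x y y0 xy.
rewrite (_ : vec2 x y = x *: vec2 1 0 + y *: vec2 0 1); last first.
  by rewrite !vec2Z vec2D; congr vec2; lra.
rewrite (le_trans (ler_normD _ _))// !normrZ mulrDl (ger0_norm y0).
apply: lerD; last by rewrite mulrC.
by rewrite mulrAC ler_wpM2r// (le_trans xy)// ler_wpM2r// ler_norm.
Qed.

Lemma height_oscillates (f : 'rV[R]_2 -> R) eps a b h : is_height f eps a b h ->
  oscillates (slice f) eps a b h /\ oscillates (fun x y => - slice f x y) eps a b h.
Proof.
move=> [xM [xm [_ _ xP oi]]].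
have diff y : 0 < y <= eps ->
   slice f (xM y) y - slice f (xm y) y = `|f (vec2 (xM y) y) - f (vec2 (xm y) y)|.
  move=> /xP[xMab _ xmax]; rewrite ger0_norm// subr_ge0.
  by have /andP[] := xmax _ xMab.
split; exists (fun y => `|f (vec2 (xM y) y) - f (vec2 (xm y) y)|) => //.
  by move=> y ye; have [? ? _] := xP y ye; exists (xM y), (xm y);
    split => //; exact: diff.
move=> y ye; have [? ? _] := xP y ye; exists (xm y), (xM y); split => //.
by rewrite -diff// opprK addrC.
Qed.

(** The excluded paths run in the graph over the whole plane and are merely continuous, which covers
    both arcs in the piece and preimages of segments under a chart of [V]. *)
Lemma valley_separates (f : 'rV[R]_2 -> R) m C eps e1 (r0 r1 r3 : R -> R) :
  0 < m -> 0 <= C -> 0 < eps -> 0 < e1 -> analytic_arc eps r1 ->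
  (forall y, 0 < y <= eps -> - (m * y) <= r0 y /\ r3 y <= m * y) ->
  (forall y x, 0 < y < e1 -> r0 y <= x <= r3 y -> `|f (vec2 x y)| <= C * y) ->
  (forall L e, 0 < L -> 0 < e -> exists y xl xr,
    [/\ 0 < y < e, r0 y <= xl < r1 y, r1 y < xr <= r3 y,
        f (vec2 xl y) = f (vec2 xr y) &
      forall y', `|y' - y| <= L * (xr - xl) ->
        0 < y' < e /\ L * (xr - xl) < `|f (vec2 xl y) - f (vec2 (r1 y') y')|]) ->
  forall L (N : set 'rV[R]_3), 0 < L -> nbhs (0 : 'rV[R]_3) N -> exists p q,
    [/\ graph f (region eps r0 r3) p /\ N p, graph f (region eps r0 r3) q /\ N q,
        0 < outer_dist p q
      & forall g : R -> 'rV[R]_3,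
        (forall i, {within `[0, 1], continuous (fun t => g t 0 i)}) ->
        g 0 = p -> g 1 = q ->
        ~ forall t, 0 <= t <= 1 ->
          graph f [set: 'rV[R]_2] (g t) /\ enorm (g t - p) <= L * outer_dist p q].
Proof.
move=> m0 C0 eps0 e10 r1a rm fC valley L N L0 nN.
have [e2 e20 eN] := near_wedge3 m0 C0 nN.
pose e := Num.min (Num.min e1 e2) eps.
have e0 : 0 < e by rewrite !lt_min e10 e20.
have [ee1 ee2 ee] : [/\ e <= e1, e <= e2 & e <= eps].
  by rewrite !ge_min !lexx !orbT.
have [y [xl [xr [/andP[y0 ye] /andP[xl0 xl1] /andP[xr1 xr3] flr sep]]]] :=
  valley L e L0 e0.
have yeps : 0 < y <= eps by rewrite y0; lra.
have [rml rmr] := rm y yeps.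
have xlr : xl < xr by lra.
have E : outer_dist (vec3 xl y (f (vec2 xl y))) (vec3 xr y (f (vec2 xl y))) = xr - xl.
  rewrite /outer_dist -scaleN1r vec3Z vec3D !mulN1r !subrr enorm_vec3_axis.
  by rewrite distrC gtr0_norm// subr_gt0.
have inN x : r0 y <= x <= r3 y -> f (vec2 x y) = f (vec2 xl y) ->
    graph f (region eps r0 r3) (vec3 x y (f (vec2 xl y))) /\ N (vec3 x y (f (vec2 xl y))).
  move=> /andP[x0 x3] fx; split.
    by apply/graph_vec3; split => //; split; rewrite !vec2E ?x0//; lra.
  apply: eN; first by rewrite y0; lra.
    by rewrite ler_norml; lra.
  by apply: fC; [rewrite y0; lra|rewrite xl0; lra].
exists (vec3 xl y (f (vec2 xl y))), (vec3 xr y (f (vec2 xl y))); split.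
- by apply: inN => //; rewrite xl0; lra.
- by apply: inN => //; lra.
- by rewrite E subr_gt0.
move=> g gc g0 g1 gP; rewrite E in gP.
have near t i : 0 <= t <= 1 ->
    `|g t 0 i - vec3 xl y (f (vec2 xl y)) 0 i| <= L * (xr - xl).
  move=> /gP[_]; apply: le_trans.
  have := coord_enorm (g t - vec3 xl y (f (vec2 xl y))) i.
  by rewrite mxE [X in _ + X]mxE.
have gy t : 0 <= t <= 1 -> `|ycoord (g t) - y| <= L * (xr - xl).
  by move=> t01; rewrite -[in X in _ - X](ycoord_vec3 xl y (f (vec2 xl y))) near.
have [||t t01|||t t01 cross] := @crosses_graph R (xcoord \o g) (ycoord \o g) r1 0 1 ler01.
- exact: gc.
- exact: gc.
- apply: (analytic_arc_continuous r1a) => /=.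
  by have [/andP[-> h] _] := sep _ (gy t t01); exact: lt_le_trans h ee.
- by rewrite /= g0 !vec3E ltW.
- by rewrite /= g1 !vec3E ltW.
(* At the crossing the height of the path is the value of [f] on the curve [x = r1 y'], too far from
   the initial height. *)
have [_] := sep _ (gy t t01); apply/negP; rewrite -leNgt.
have [[q _ qE] _] := gP t t01.
have -> : f (vec2 (r1 (ycoord (g t))) (ycoord (g t))) = zcoord (g t).
  by rewrite -cross /= -qE !vec3E vec2_coords.
by rewrite distrC -[X in _ - X](zcoord_vec3 xl y (f (vec2 xl y))) near.
Qed.

Lemma lipschitz_within (h : R -> R) M : 0 < M ->
  (forall s t, 0 <= s <= 1 -> 0 <= t <= 1 -> `|h s - h t| <= M * `|s - t|) ->
  {within `[0, 1], continuous h}.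
Proof.
move=> M0 hM; apply/subspace_continuousP => s /=; rewrite in_itv/= => s01.
apply/cvgrPdist_lt => e e0; rewrite near_withinE; near=> t => /=.
rewrite in_itv/= => t01; rewrite (le_lt_trans (hM s t s01 t01))//.
rewrite mulrC -ltr_pdivlMr//; near: t.
by apply: (cvgrPdist_lt id s).1; [exact: cvg_id|rewrite divr_gt0].
Unshelve. all: by end_near.
Qed.

(* The path is the preimage of a segment under the bilipschitz chart. *)
Lemma bilipschitz_pullback (X : set 'rV[R]_3) : X 0 ->
  bilipschitz_germs X [set: 'rV[R]_2] ->
  exists2 L, 0 < L & exists2 N : set 'rV[R]_3, nbhs (0 : 'rV[R]_3) N &
    forall p q, X p -> X q -> N p -> N q -> exists g : R -> 'rV[R]_3,
      [/\ forall i, {within `[0, 1], continuous (fun t => g t 0 i)},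
          g 0 = p, g 1 = q &
          forall t, 0 <= t <= 1 -> X (g t) /\ enorm (g t - p) <= L * outer_dist p q].
Proof.
move=> X0 [A [B [phi [[AX nA] [_ nB] phi0 [[phiAB phi_inj phi_surj] [K K0 phiK]]]]]].
have {}nB : nbhs (0 : 'rV[R]_2) B.
  have h : \forall u \near (0 : 'rV[R]_2), [set: 'rV[R]_2] u -> B u := nB.
  by apply: filterS h => u; apply.
have /nbhs_ballP[d /= d0 dB] := nB.
(* One factor [K] bounds the length of the segment between the images, the other is lost in pulling
   it back. *)
exists (K * K); first exact: mulr_gt0.
(* The bound by [d] puts both images in a ball inside [B], which is convex and so contains the
   segment between them. *)
exists [set p | (X p -> A p) /\ K * enorm p < d].
  have s3 : 0 < K * Num.sqrt 3%:R :> R by rewrite mulr_gt0// sqrtr_gt0.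
  have nsmall : \forall p \near (0 : 'rV[R]_3), `|p| < d / (K * Num.sqrt 3%:R).
    by apply: nbhs0_lt; rewrite divr_gt0.
  near=> p; split; first by near: p; exact: nA.
  apply: (@le_lt_trans _ _ (K * Num.sqrt 3%:R * `|p|)).
    by rewrite -mulrA ler_pM2l// enorm_le_norm.
  by rewrite mulrC -ltr_pdivlMr//; near: p.
move=> p q Xp Xq [/(_ Xp) Ap pd] [/(_ Xq) Aq qd].
have A0 : A 0 by apply: (nbhs_singleton nA).
have small u : A u -> K * enorm u < d -> `|phi u| < d.
  move=> Au; apply: le_lt_trans; rewrite (le_trans (norm_le_enorm _))//.
  by have /andP[_] := phiK u 0 Au A0; rewrite phi0 /outer_dist !subr0.
pose seg t := phi p + t *: (phi q - phi p).
have segB t : 0 <= t <= 1 -> B (seg t).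
  move=> /andP[t0 t1]; apply: dB; rewrite -ball_normE /= sub0r normrN.
  rewrite /seg (_ : _ + _ = (1 - t) *: phi p + t *: phi q); last first.
    by rewrite scalerBr scalerBl scale1r addrA addrAC.
  rewrite (le_lt_trans (ler_normD _ _))// !normrZ !ger0_norm ?subr_ge0//.
  have hp := small p Ap pd; have hq := small q Aq qd.
  have [->|tn0] := eqVneq t 0; first by rewrite subr0 mul1r mul0r addr0.
  have tp : 0 < t by rewrite lt_neqAle eq_sym tn0.
  have : t * `|phi q| < t * d by rewrite ltr_pM2l.
  have : (1 - t) * `|phi p| <= (1 - t) * d by rewrite ler_wpM2l ?subr_ge0// ltW.
  lra.
have /choice[g gP] t : exists v, 0 <= t <= 1 -> A v /\ phi v = seg t.
  have [t01|//] := pselect (0 <= t <= 1); last by exists 0.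
  by have [v Av vE] := phi_surj _ (segB t t01); exists v.
have A_inj u v : A u -> A v -> phi u = phi v -> u = v.
  by move=> Au Av; apply: phi_inj; rewrite inE.
have t0 : 0 <= (0 : R) <= 1 by rewrite lexx ler01.
have t1 : 0 <= (1 : R) <= 1 by rewrite lexx ler01.
have g0 : g 0 = p.
  have [Ag gE] := gP 0 t0; apply: A_inj => //.
  by rewrite gE /seg scale0r addr0.
have g1 : g 1 = q.
  have [Ag gE] := gP 1 t1; apply: A_inj => //.
  by rewrite gE /seg scale1r addrC subrK.
have gL s t : 0 <= s <= 1 -> 0 <= t <= 1 ->
    enorm (g s - g t) <= K * K * outer_dist p q * `|s - t|.
  move=> s01 t01; have [As sE] := gP s s01; have [At tE] := gP t t01.
  have /andP[h _] := phiK _ _ As At.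
  have /andP[_ h'] := phiK _ _ Aq Ap.
  rewrite ler_pdivrMl// in h; apply: (le_trans h).
  rewrite -!mulrA ler_pM2l// sE tE /outer_dist.
  rewrite (_ : seg s - seg t = (s - t) *: (phi q - phi p)); last first.
    by rewrite /seg opprD addrACA subrr add0r -scalerBl.
  rewrite enormZ mulrC mulrA ler_wpM2r//.
  by move: h'; rewrite /outer_dist -(opprB p q) -(scaleN1r (p - q)) enormZ normrN1 mul1r.
have Lpq : 0 <= K * K * outer_dist p q.
  by apply: mulr_ge0; [rewrite mulr_ge0// ltW|exact: enorm_ge0].
exists g; split => //.
(* The added 1 keeps the constant positive when [p = q]. *)
- move=> i; apply: (@lipschitz_within _ (K * K * outer_dist p q + 1)).
    exact: ltr_wpDl.
  move=> s t s01 t01; have := coord_enorm (g s - g t) i; rewrite !mxE => /le_trans; apply.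
  by rewrite (le_trans (gL s t s01 t01))// mulrDl lerDl mul1r.
- move=> t t01; split; first by apply: AX; case: (gP t t01).
  rewrite -g0 (le_trans (gL t 0 t01 t0))// g0 subr0 ler_piMr//.
  by case/andP: t01 => t_ge0; rewrite ger0_norm.
Unshelve. all: by end_near.
Qed.

End Walls.

(** * Distortion of the piece and of bilipschitz charts *)

Theorem theorem4p1 (R : realType)
    (U : set 'rV[R]_2) (f : 'rV[R]_2 -> R) (m eps : R)
    (r0 r1 r2 r3 : R -> R) (w h1 h3 : rat) :
  nbhs (0 : 'rV[R]_2) U ->
  semialgebraic_fun U f ->
  {for (0 : 'rV[R]_2), continuous f} ->
  f 0 = 0 ->
  let V := graph f U in
  (forall p, V p -> p != 0 -> C1_surface_at V p) ->
  tangent_cone V = [set v | zcoord v = 0] ->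
  exceptional V (vec3 0 1 0) ->
  0 < m -> 0 < eps ->
  wedge m eps `<=` U ->
  (forall x y, 0 <= y -> `|x| <= m * y ->
     exceptional V (vec3 x y 0) -> vec3 x y 0 = vec3 0 1 0) ->
  piece f m eps r0 r3 ->
  piece f m eps r0 r1 -> piece f m eps r1 r2 -> piece f m eps r2 r3 ->
  FL f eps r1 r2 ->
  (NFI f m eps r0 r1 /\ NFD f m eps r2 r3) \/
  (NFD f m eps r0 r1 /\ NFI f m eps r2 r3) ->
  is_width eps r0 r3 w ->
  is_height f eps r0 r1 h1 ->
  is_height f eps r2 r3 h3 ->
  w < Num.min h1 h3 ->
  ~ l_regular (graph f (region eps r0 r3)) /\
  ~ bilipschitz_germs V [set: 'rV[R]_2].
Proof.
move=> nU _ fc f0 V Vsmooth Vcone _ m0 eps0 _ _ P03 P01 P12 P23 fl nfid wd ht1 ht3 wh.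
have [C C0 normC] := norm_vec2_le m.
have r03m y : 0 < y <= eps -> - (m * y) <= r0 y /\ r3 y <= m * y.
  by move=> ye; have [_ _ /(_ y ye)[]] := P03.
have rord y : 0 < y <= eps -> [/\ r0 y <= r1 y, r1 y <= r2 y & r2 y <= r3 y].
  move=> ye; have [_ _ /(_ y ye)[_ /ltW-> _] _] := P01.
  have [_ _ /(_ y ye)[_ /ltW-> _] _] := P12.
  by have [_ _ /(_ y ye)[_ /ltW-> _] _] := P23.
have cone : tangent_cone V `<=` [set v | zcoord v = 0] by rewrite Vcone.
have fnorm := tangent_cone_horizontal nU fc f0 cone.
have [e1 e10 e1P] := near_wedge m0 (filterI fnorm (nbhs_interior nU)).
pose e2 := Num.min e1 eps.
have e20 : 0 < e2 by rewrite lt_min e10.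
(* Away from the origin, continuity comes from the surface being smooth, and the linear bound from
   its horizontal tangent cone. *)
have local y x : 0 < y < e2 -> r0 y <= x <= r3 y ->
    {for x, continuous ((slice f) ^~ y)} /\ `|slice f x y| <= C * y.
  move=> /andP[y0]; rewrite lt_min => /andP[ye1 yeps] /andP[r0x xr3].
  have [] := r03m y; first by rewrite y0 ltW.
  move=> rm0 rm3.
  have xm : `|x| <= m * y by rewrite ler_norml; lra.
  have [] := e1P x y _ xm; first by rewrite y0.
  move=> fn nUx; split; last by rewrite (le_trans fn)// normC// ltW.
  have S : C1_surface_at V (vec3 x y (f (vec2 x y))).
    apply: Vsmooth; first by apply/graph_vec3; split => //; exact: nbhs_singleton.
    apply/eqP => /(congr1 ycoord); rewrite ycoord_vec3 /ycoord mxE => /eqP.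
    by rewrite gt_eqF.
  have xyc : {for x, continuous (fun t : R => (t, y))}.
    by apply: (@cvg_pair _ _ _ _ (nbhs x) (nbhs y)); [exact: cvg_id|exact: cvg_cst].
  exact: (@continuous_comp _ _ _ (fun t : R => (t, y)) _ x xyc
    (C1_graph_continuous nUx S)).
have valley L e : 0 < L -> 0 < e -> exists y xl xr,
    [/\ 0 < y < e, r0 y <= xl < r1 y, r1 y < xr <= r3 y,
        f (vec2 xl y) = f (vec2 xr y) &
      forall y', `|y' - y| <= L * (xr - xl) ->
        0 < y' < e /\ L * (xr - xl) < `|f (vec2 xl y) - f (vec2 (r1 y') y')|].
  move=> L0 e0.
  have [fl1 fl2] := FL_incr fl.
  have [osc1 nosc1] := height_oscillates ht1.
  have [osc3 nosc3] := height_oscillates ht3.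
  (* If the left piece is [NFI], the slices of [f] itself are valleys; if it is [NFD], those of
     [- f] are. *)
  case: nfid => -[n1 n3].
    apply: (@narrow_valley R (slice f) eps C e2 r0 r1 r2 r3 w h1 h3) => //.
    - exact: NFI_incr n1.
    - exact: NFD_incr n3.
  have opp F a b : incr_le F eps a b -> incr_le (fun x y => - - F x y) eps a b.
    by move=> [K K0 h]; exists K => // y x x' ye ? ? ?; rewrite !opprK; exact: h.
  have nlocal y x : 0 < y < e2 -> r0 y <= x <= r3 y ->
      {for x, continuous (fun x => - slice f x y)} /\ `|- slice f x y| <= C * y.
    move=> ye xr; have [c b] := local y x ye xr.
    by split; [exact: continuousN|rewrite normrN].
  have [y [xl [xr [? ? ? fE sep]]]] := narrow_valley eps0 C0 e20 rord nlocal
    (NFD_incr n1) (opp _ _ _ fl1) (opp _ _ _ (NFI_incr n3)) wd nosc1 nosc3 wh L0 e0.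
  exists y, xl, xr; split => //; first exact: oppr_inj fE.
  move=> y' /sep[ye']; split => //.
  by move: b; rewrite -opprD normrN.
have r1a : analytic_arc eps r1 by case: P01.
have sep := valley_separates m0 C0 eps0 e20 r1a r03m
  (fun y x h1 h2 => (local y x h1 h2).2) valley.
split.
  move=> [A nA [K K0 reg]].
  (* The inner distance is an infimum, so an actual arc is only found with some slack over [K]. *)
  have K1 : 0 < K + 1 by lra.
  have [p [q [[Vp Ap] [Vq Aq] pq path]]] := sep _ _ K1 nA.
  have Kpq : K * outer_dist p q < (K + 1) * outer_dist p q by rewrite ltr_pM2r// ltrDl.
  have [g [[ga g0 g1 gX] gK]] :=
    inner_dist_le_path (reg p q (conj Vp Ap) (conj Vq Aq)) Kpq.
  apply: (path g) => // [i|t t01]; first exact: piecewise_analytic_coord_continuous.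
  by split; [have [u _ uE] := gX t t01; exists u|exact: gK].
move=> bl.
have V0 : V 0.
  exists 0; first exact: nbhs_singleton nU.
  by rewrite f0; apply/rowP => -[[|[|[|//]]] i3]; rewrite /xcoord/ycoord !mxE.
have [L L0 [N nN pull]] := bilipschitz_pullback V0 bl.
(* Intersecting with the cylinder over [U] ensures that the two points found on the graph belong to
   [V]. *)
have nNU : nbhs (0 : 'rV[R]_3) (N `&` [set p | U (vec2 (xcoord p) (ycoord p))]).
  apply: filterI => //.
  have cc : vec2 (xcoord p) (ycoord p) @[p --> (0 : 'rV[R]_3)] --> (0 : 'rV[R]_2).
    have -> : 0 = vec2 (xcoord (0 : 'rV[R]_3)) (ycoord (0 : 'rV[R]_3)).
      by apply/rowP => -[[|[|//]] i2]; rewrite /xcoord /ycoord !mxE.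
    have h : (xcoord p, ycoord p) @[p --> (0 : 'rV[R]_3)] -->
        (xcoord (0 : 'rV[R]_3), ycoord (0 : 'rV[R]_3)).
      apply: (@cvg_pair _ _ _ _ (nbhs (xcoord (0 : 'rV[R]_3)))
        (nbhs (ycoord (0 : 'rV[R]_3)))).
      - exact: (nbhs_filter (0 : 'rV[R]_3)).
      - exact: (@coord_continuous R 1 3 0 ord0).
      - exact: (@coord_continuous R 1 3 0 (inord 1)).
    exact: (cvg_comp _ _ h (@vec2_continuous R (_, _))).
  exact: cc _ nU.
have [p [q [[[u _ uE] [Np Up]] [[v _ vE] [Nq Uq]] pq path]]] := sep _ _ L0 nNU.
have Vp : V p by exists u => //; move: Up; rewrite /= -uE !vec3E vec2_coords.
have Vq : V q by exists v => //; move: Uq; rewrite /= -vE !vec3E vec2_coords.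
have [g [gc g0 g1 gV]] := pull p q Vp Vq Np Nq.
apply: (path g) => // t /gV[[s _ sE] ?].
by split => //; exists s.
Qed.
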